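(* Let $\mathcal Y=\mathcal M(\Omega)$ be the space of Radon measures with the total variation norm and let $$\mathcal H(v\mid f)=\begin{cases}d_\phi(v\mid f),& v\in\mathcal P(\Omega),\ v\ll f,\\ \infty,&\text{else,}\end{cases}\qquad f\in\mathcal P(\Omega).$$ Assume that (i) $\mathcal J:\mathcal X\to[0,+\infty]$ is proper, convex, weakly-* lower semicontinuous with weakly-* sequentially compact non-empty sublevel sets; (ii) $\mathcal H$ is proper, convex in its first argument, weakly-* lower semicontinuous jointly in both arguments, and $\mathcal H(v\mid f)=0$ iff $v=f$; (iii) $A,A^l_n,A^u_n:\mathcal X\to\mathcal Y$ are weak-* to weak-* continuous; (iv) there exists $\mu^\dagger\in\mathcal Y^*\times\mathcal Y^*$, $\mu^\dagger\ge0$, with $p^\dagger:=-B^*\mu^\dagger\in\partial\mathcal J(u^\dagger_{\mathcal J})$; (v) $A^l_n\le A\le A^u_n$ for all $n$, $\|A^u_n-A^l_n\|\le\eta_n\to0$, $\mathcal H(\bar f\mid f_n)\le\delta_n\to0$, $\alpha_n\to0$. Suppose that $E^*\mu^\dagger\in\mathcal C(\Omega)$ and that $\phi^*(x)=x+r(x)$ with $r(x)/x\to0$ as $x\to0$. Let $(u_n,v_n)$ solve $$\min_{u\in\mathcal X,\ v\in\mathcal Y}\frac1{\alpha_n}\mathcal H(v\mid f_n)+\mathcal J(u)\quad\text{subject to}\quad A^l_nu\le v\le A^u_nu.$$ Then $$D^{p^\dagger}_{\mathcal J}(u_n,u^\dagger_{\mathcal J})=O\left(\frac{\delta_n}{\alpha_n}+\frac{r(\alpha_n)}{\alpha_n}+\eta_n\right).$$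 Under the additional assumption that $A,A^l_n,A^u_n$ are bounded as operators $\mathcal X\to L^\infty(\Omega)\subset\mathcal M(\Omega)$ (the problem being posed with data space $L^\infty(\Omega)$, an AM-space with unit $\mathbf 1$, and the strict feasibility condition stated in the context being satisfied), the same rate holds for the symmetric Bregman distance $D^{\mathrm{symm}}_{\mathcal J}(u_n,u^\dagger_{\mathcal J})$.
   Context: $\phi:(0,\infty)\to\mathbb R$ is convex with $\phi(1)=0$ and (the paper's normalisation) $\phi\ge0$; $\phi^*(x)=\sup_{y>0}[xy-\phi(y)]$. $\mathcal P(\Omega)\subset\mathcal M(\Omega)$ is the set of probability measures ($\Omega$ a compact metric space, $\mathcal M(\Omega)=\mathcal C(\Omega)^*$), and $d_\phi(\rho\mid\nu)=\int_\Omega\phi\bigl(\frac{d\rho}{d\nu}\bigr)\,d\nu$ for $\rho\ll\nu$. $\mathcal X=\mathcal U^*$ is the dual of a Banach lattice with dual norm and order. $A:\mathcal X\to\mathcal Y$ is bounded linear and regular (difference of two positive operators), $A^l_n,A^u_n:\mathcal X\to\mathcal Y$ bounded linear, $A^l_n\le A\le A^u_n$ means $A^l_nu\le Au\le A^u_nu$ for all $u\ge0$. $\bar f,f_n\in\mathcal P(\Omega)$, $\alpha_n>0$. $u^\dagger_{\mathcal J}\ge0$ satisfies $Au^\dagger_{\mathcal J}=\bar f$ and $\mathcal J(u^\dagger_{\mathcal J})\le\mathcal J(u)$ whenever $Au=\bar f$. $Bu=(Au,-Au)$, $B_nu=(A^l_nu,-A^u_nu)$, $Ev=(v,-v)$,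 orders on products componentwise. For $p\in\partial\mathcal J(w)$: $D^p_{\mathcal J}(u,w)=\mathcal J(u)-\mathcal J(w)-\langle p,u-w\rangle$; for $q\in\partial\mathcal J(u)$, $p\in\partial\mathcal J(w)$: $D^{\mathrm{symm}}_{\mathcal J}(u,w)=\langle q-p,u-w\rangle$. For the symmetric statement the subgradients are $p^\dagger$ and $p_n=-B_n^*\mu_n\in\partial\mathcal J(u_n)$, where $\mu_n$ solves the dual problem $\sup_{\mu\ge0}-\frac1{\alpha_n}\mathcal H^*(\alpha_nE^*\mu\mid f_n)-\mathcal J^*(-B_n^*\mu)$ (conjugates, the one of $\mathcal H$ in its first argument, with respect to the data space $L^\infty(\Omega)$), and the strict feasibility condition is: for every $n$ there are $u_0\in\operatorname{dom}\mathcal J$, $v_0\in\operatorname{dom}\mathcal H(\cdot\mid f_n)$, $\varepsilon>0$ with $A^l_nu_0+\varepsilon\mathbf 1\le v_0\le A^u_nu_0-\varepsilon\mathbf 1$. $L^\infty(\Omega)$ is taken with respect to a fixed finite reference measure and embedded in $\mathcal M(\Omega)$ as densities.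
   Formalization: The rate with r(α_n)/α_n is false for general r (e.g. r(x)=exp(-1/|x|) near 0); proved instead with r(Kα_n)/α_n for every K bounding the oscillation of E*μ†, and with r(α_n)/α_n itself when r(2x)=O(r(x)) as x→0+. *)

(* Defs.v *)
From HB Require Import structures.
From mathcomp Require Import all_boot all_order all_algebra.
From mathcomp Require Import all_classical all_reals all_analysis.
From mathcomp Require Import ess_sup_inf.

Set Implicit Arguments.
Unset Strict Implicit.
Unset Printing Implicit Defensive.

Import Order.TTheory GRing.Theory Num.Def Num.Theory.
Import numFieldNormedType.Exports.

Local Open Scope classical_set_scope.
Local Open Scope ring_scope.

Section BoundedLinear.
Context {R : realType} (V W : normedModType R).

Definition bounded_linear (f : V -> W) : Prop :=
  linear f /\ exists M : R, forall x, `|f x| <= M * `|x|.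

Definition blin_pred : {pred V -> W} := fun f => `[< bounded_linear f >].

Record blin := BLin { blin_fun :> V -> W ; blin_funP : blin_fun \in blin_pred }.

HB.instance Definition _ := [isSub for blin_fun].
HB.instance Definition _ := [Choice of blin by <:].

Lemma blin_submod : submod_closed blin_pred.
Proof.
split.
  apply/asboolP; split; first by move=> a x y; rewrite /= scaler0 addr0.
  by exists 0 => x; rewrite normr0 mul0r.
move=> a f g /asboolP[lf [M fM]] /asboolP[lg [N gN]]; apply/asboolP; split.
  move=> b x y /=; rewrite !fctE lf lg !scalerDr !scalerA (mulrC a b).
  by rewrite !addrA; congr (_ + _); rewrite addrAC.
exists (`|a| * M + N) => x; rewrite (le_trans (ler_normD _ _))//.
rewrite mulrDl lerD// normrZ -mulrA ler_wpM2l//.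
Qed.

HB.instance Definition _ :=
  GRing.isSubmodClosed.Build R (V -> W) blin_pred blin_submod.
HB.instance Definition _ := [SubChoice_isSubLmodule of blin by <:].

Lemma blin_bounded (f : blin) : bounded_linear f.
Proof. exact/asboolP/blin_funP. Qed.

Lemma blin_linear (f : blin) : linear f.
Proof. by have [] := blin_bounded f. Qed.

HB.instance Definition _ (f : blin) :=
  GRing.isLinear.Build R V W _ (f : V -> W) (blin_linear f).

Definition opnorm (f : blin) : R :=
  sup [set `|f x| | x in [set x : V | `|x| <= 1]].

Lemma opnorm_has_sup (f : blin) :
  has_sup [set `|f x| | x in [set x : V | `|x| <= 1]].
Proof.
split; first by exists `|f 0|, 0 => //=; rewrite normr0.
have [_ [M fM]] := blin_bounded f; exists `|M| => _ [x /= x1 <-].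
rewrite (le_trans (fM x))// (le_trans (ler_norm _))// normrM normr_id.
by rewrite ler_piMr.
Qed.

Lemma opnorm_ub (f : blin) x : `|x| <= 1 -> `|f x| <= opnorm f.
Proof.
by move=> x1; apply: ub_le_sup; [case: (opnorm_has_sup f)|exists x].
Qed.

Lemma opnorm_le (f : blin) M :
  (forall x, `|x| <= 1 -> `|f x| <= M) -> opnorm f <= M.
Proof.
move=> fM; apply: ge_sup; first by case: (opnorm_has_sup f).
by move=> _ [x x1 <-]; exact: fM.
Qed.

Lemma opnorm_ge0 (f : blin) : 0 <= opnorm f.
Proof. by rewrite (le_trans _ (@opnorm_ub f 0 _)) ?normr0. Qed.

Lemma opnormP (f : blin) x : `|f x| <= opnorm f * `|x|.
Proof.
have [->|x0] := eqVneq x 0; first by rewrite linear0 !normr0 mulr0.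
rewrite -ler_pdivrMr ?normr_gt0//.
have := @opnorm_ub f (`|x|^-1 *: x).
by rewrite linearZ/= !normrZ normfV normr_id mulVf ?normr_eq0// mulrC; exact.
Qed.

Lemma opnormD (f g : blin) : opnorm (f + g) <= opnorm f + opnorm g.
Proof.
apply: opnorm_le => x x1; rewrite (le_trans (ler_normD _ _))//.
by rewrite lerD ?opnorm_ub.
Qed.

Lemma opnormZ_le (a : R) (f : blin) : opnorm (a *: f) <= `|a| * opnorm f.
Proof.
by apply: opnorm_le => x x1; rewrite normrZ ler_wpM2l// opnorm_ub.
Qed.

Lemma opnormZ (a : R) (f : blin) : opnorm (a *: f) = `|a| * opnorm f.
Proof.
apply/eqP; rewrite eq_le opnormZ_le/=.
have [->|a0] := eqVneq a 0; first by rewrite normr0 mul0r opnorm_ge0.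
rewrite -ler_pdivlMl ?normr_gt0// -normfV.
by rewrite (le_trans _ (opnormZ_le _ _))// scalerA mulVf// scale1r.
Qed.

Lemma opnorm0_eq0 (f : blin) : opnorm f = 0 -> f = 0.
Proof.
move=> f0; apply/val_inj/funext => x; apply/eqP.
by rewrite -normr_le0 (le_trans (opnormP f x))// f0 mul0r.
Qed.

HB.instance Definition _ :=
  Lmodule_isNormed.Build R blin opnormD opnormZ opnorm0_eq0.

End BoundedLinear.

Arguments blin {R} V W.
Arguments blin_pred {R} V W.


Notation "V '^dual'" := (blin V _^o) (at level 2, format "V '^dual'") : type_scope.

Section Composition.
Context {R : realType} {V W Z : normedModType R}.

Lemma bcomp_subproof (g : blin W Z) (f : blin V W) :
  (g \o f : V -> Z) \in blin_pred V Z.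
Proof.
apply/asboolP; split; first by move=> a x y /=; rewrite !linearP.
exists (opnorm g * opnorm f) => x /=.
rewrite (le_trans (opnormP g _))// -mulrA ler_wpM2l ?opnorm_ge0//.
exact: opnormP.
Qed.

Definition bcomp (g : blin W Z) (f : blin V W) : blin V Z :=
  BLin (bcomp_subproof g f).

End Composition.

Section Pairs.
Context {R : realType} {V W : normedModType R}.

Lemma bpair_subproof (f g : blin V W) :
  ((fun x => (f x, g x)) : V -> (W * W)%type) \in blin_pred V (W * W)%type.
Proof.
apply/asboolP; split; first by move=> a x y /=; rewrite !linearP.
exists (maxr (opnorm f) (opnorm g)) => x.
rewrite prod_normE/= ge_max.
by rewrite !(le_trans (opnormP _ _))// ler_wpM2r// le_max lexx ?orbT.
Qed.

Definition bpair (f g : blin V W) : blin V (W * W)%type :=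
  BLin (bpair_subproof f g).

Lemma bid_subproof : (id : V -> V) \in blin_pred V V.
Proof. by apply/asboolP; split => //; exists 1 => x; rewrite mul1r. Qed.

Definition bid : blin V V := BLin bid_subproof.

Lemma dual_pair_subproof (mu : V^dual * V^dual) :
  ((fun y => mu.1 y.1 + mu.2 y.2) : (V * V)%type -> R^o)
    \in blin_pred (V * V)%type R^o.
Proof.
apply/asboolP; split.
  move=> a x y /=; rewrite !linearP /= scalerDr !addrA; congr (_ + _).
  by rewrite addrAC.
exists (opnorm mu.1 + opnorm mu.2) => x; rewrite (le_trans (ler_normD _ _))//.
rewrite mulrDl lerD// (le_trans (opnormP _ _))// ler_wpM2l ?opnorm_ge0//.
  by rewrite prod_normE le_max lexx.
by rewrite prod_normE le_max lexx orbT.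
Qed.

Definition dual_pair (mu : V^dual * V^dual) : (V * V)%type^dual :=
  BLin (dual_pair_subproof mu).

End Pairs.

(* The order is a mixin of its own because the order structures of the library
   cannot be joined with [normedModType] outside of the library. *)
HB.mixin Record NormedModule_isOrdered (R : realType) V & NormedModule R V := {
  vle : V -> V -> Prop ;
  vle_refl : forall x, vle x x ;
  vle_anti : forall x y, vle x y -> vle y x -> x = y ;
  vle_trans : forall y x z, vle x y -> vle y z -> vle x z ;
  vle_add2r : forall z x y, vle x y -> vle (x + z) (y + z) ;
  vle_scale : forall (a : R) x y, 0 <= a -> vle x y -> vle (a *: x) (a *: y) }.

#[short(type="orderedNormedModType")]
HB.structure Definition OrderedNormedModule (R : realType) :=
  {V of NormedModule R V & NormedModule_isOrdered R V}.

Notation "x ⪯ y" := (vle x y) (at level 70, no associativity) : ring_scope.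

HB.mixin Record OrderedNormedModule_isBanachLattice (R : realType) V
    & OrderedNormedModule R V & Complete V := {
  vjoin : V -> V -> V ;
  vjoinP : forall x y z, vle (vjoin x y) z <-> vle x z /\ vle y z ;
  vlattice_norm : forall x y,
    vle (vjoin x (- x)) (vjoin y (- y)) -> `|x| <= `|y| }.

#[short(type="banachLatticeType")]
HB.structure Definition BanachLattice (R : realType) :=
  {V of CompleteNormedModule R V & OrderedNormedModule R V
      & OrderedNormedModule_isBanachLattice R V}.

Section DualOrder.
Context {R : realType}.

Definition dual_ge0 {V : orderedNormedModType R} (f : V^dual) : Prop :=
  forall x : V, 0 ⪯ x -> 0 <= f x.

Definition positive_op {V W : orderedNormedModType R} (A : blin (V^dual) W) :=
  forall u : V^dual, dual_ge0 u -> 0 ⪯ A u.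

Definition regular_op {V W : orderedNormedModType R} (A : blin (V^dual) W) :=
  exists A1 A2 : blin (V^dual) W,
    [/\ positive_op A1, positive_op A2 & A = A1 - A2].

Definition op_le {V W : orderedNormedModType R} (A B : blin (V^dual) W) :=
  forall u : V^dual, dual_ge0 u -> A u ⪯ B u.

End DualOrder.

Section SignedMeasures.
Context {d : measure_display} (T : measurableType d) (R : realType).

(* The value outside of the sigma-algebra is normalized to [0], so that two
   signed measures are equal iff they agree on the measurable sets. *)
Definition smeas_pred : {pred set T -> R^o} := fun m => `[<
  [/\ m set0 = 0, semi_sigma_additive (fun A => (m A)%:E)
    & forall A, ~ measurable A -> m A = 0] >].

Record smeas :=
  SMeas { smeas_fun :> set T -> R^o ; smeas_funP : smeas_fun \in smeas_pred }.

HB.instance Definition _ := [isSub for smeas_fun].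
HB.instance Definition _ := [Choice of smeas by <:].

Definition charge_of_fun (m : set T -> R^o) of m \in smeas_pred :=
  fun A => (m A)%:E.

Section ChargeOfFun.
Variables (m : set T -> R^o) (mP : m \in smeas_pred).

Let c0 : charge_of_fun mP set0 = 0%E.
Proof. by have /asboolP[m0 _ _] := mP; rewrite /charge_of_fun m0. Qed.

Let cfin x : measurable x -> charge_of_fun mP x \is a fin_num.
Proof. by []. Qed.

Let csigma : semi_sigma_additive (charge_of_fun mP).
Proof. by have /asboolP[] := mP. Qed.

HB.instance Definition _ := isCharge.Build _ T R (charge_of_fun mP)
  c0 cfin csigma.
End ChargeOfFun.

Lemma smeas_submod : submod_closed smeas_pred.
Proof.
split.
  apply/asboolP; split => //.
  rewrite (_ : (fun _ => _) = @czero _ T R)//.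
  exact: charge_semi_sigma_additive.
move=> a f g fP gP; apply/asboolP; split.
- move: fP gP => /asboolP[f0 _ _] /asboolP[g0 _ _].
  by rewrite !fctE f0 g0 scaler0 addr0.
- rewrite (_ : (fun _ => _) =
    cadd (cscale a (charge_of_fun fP)) (charge_of_fun gP)).
    exact: charge_semi_sigma_additive.
  by apply/funext => A.
- move: fP gP => /asboolP[_ _ f0] /asboolP[_ _ g0] A mA.
  by rewrite !fctE f0// g0// scaler0 addr0.
Qed.

HB.instance Definition _ :=
  GRing.isSubmodClosed.Build R (set T -> R^o) smeas_pred smeas_submod.
HB.instance Definition _ := [SubChoice_isSubLmodule of smeas by <:].

Definition charge_of_smeas (m : smeas) : {charge set T -> \bar R} :=
  charge_of_fun (smeas_funP m).

Lemma smeas_eqP (m n : smeas) :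
  (forall A, measurable A -> m A = n A) -> m = n.
Proof.
move=> mn; apply/val_inj/funext => A.
have [mA|mA] := pselect (measurable A); first exact: mn.
have /asboolP[_ _ /(_ _ mA) m0] := smeas_funP m.
have /asboolP[_ _ /(_ _ mA) n0] := smeas_funP n.
by rewrite /= m0 n0.
Qed.

Definition smeas_hahn (m : smeas) :=
  let: exist P mP := cid (Hahn_decomposition (charge_of_smeas m)) in
  let: exist N mN := cid mP in
  exist (fun PN : set T * set T =>
    hahn_decomposition (charge_of_smeas m) PN.1 PN.2) (P, N) mN.

Definition pos_part (m : smeas) : {finite_measure set T -> \bar R} :=
  jordan_pos (svalP (smeas_hahn m)).

Definition neg_part (m : smeas) : {finite_measure set T -> \bar R} :=
  jordan_neg (svalP (smeas_hahn m)).

Definition variation (m : smeas) : {measure set T -> \bar R} :=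
  charge_variation (svalP (smeas_hahn m)).

Definition tv_norm (m : smeas) : R := fine (variation m setT).

Lemma le_variation (m : smeas) A : measurable A ->
  (`|m A|%:E <= variation m A)%E.
Proof. exact: (abse_charge_variation (svalP (smeas_hahn m))). Qed.

Lemma variationT_fin (m : smeas) : variation m setT \is a fin_num.
Proof. by rewrite /variation/= /charge_variation fin_numD !fin_num_measure. Qed.

Lemma tv_norm_split (m : smeas) P N : measurable P -> measurable N ->
  P `|` N = setT -> P `&` N = set0 -> `|m P| + `|m N| <= tv_norm m.
Proof.
move=> mP mN PNT PN0; rewrite -lee_fin /tv_norm fineK ?variationT_fin//.
by rewrite -PNT measureU// EFinD leeD ?le_variation.
Qed.

Lemma tv_norm_hahn (m : smeas) : exists P N, [/\ measurable P, measurable N,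
  P `|` N = setT, P `&` N = set0 & tv_norm m = m P - m N].
Proof.
rewrite /tv_norm /variation/=; case: (smeas_hahn m) => -[P N] /= PN.
have [[mP _] [mN _] PNT PN0] := PN; exists P, N; split => //.
rewrite /charge_variation jordan_posE cjordan_posE jordan_negE cjordan_negE.
by rewrite /crestr0 mem_set// /crestr !setTI.
Qed.

Lemma tv_normD (m n : smeas) : tv_norm (m + n) <= tv_norm m + tv_norm n.
Proof.
have [P [N [mP mN PNT PN0 ->]]] := tv_norm_hahn (m + n).
rewrite (le_trans _ (lerD (tv_norm_split m mP mN PNT PN0)
  (tv_norm_split n mP mN PNT PN0)))//.
have -> : (m + n) P - (m + n) N = (m P - m N) + (n P - n N).
  by rewrite /= !fctE opprD addrACA.
by rewrite lerD// (le_trans (ler_norm _))// ler_normB.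
Qed.

Lemma tv_norm_ge0 (m : smeas) : 0 <= tv_norm m.
Proof. by rewrite fine_ge0. Qed.

Lemma tv_normZ_le a (m : smeas) : tv_norm (a *: m) <= `|a| * tv_norm m.
Proof.
have [P [N [mP mN PNT PN0 ->]]] := tv_norm_hahn (a *: m).
rewrite (le_trans _ (ler_wpM2l (normr_ge0 a) (tv_norm_split m mP mN PNT PN0)))//.
have -> : (a *: m) P - (a *: m) N = a * (m P - m N) by rewrite mulrBr.
by rewrite (le_trans (ler_norm _))// normrM ler_wpM2l// ler_normB.
Qed.

Lemma tv_normZ a (m : smeas) : tv_norm (a *: m) = `|a| * tv_norm m.
Proof.
apply/eqP; rewrite eq_le tv_normZ_le/=.
have [->|a0] := eqVneq a 0; first by rewrite normr0 mul0r tv_norm_ge0.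
rewrite -ler_pdivlMl ?normr_gt0// -normfV.
by rewrite (le_trans _ (tv_normZ_le _ _))// scalerA mulVf// scale1r.
Qed.

Lemma tv_norm0_eq0 (m : smeas) : tv_norm m = 0 -> m = 0.
Proof.
move=> m0; apply: smeas_eqP => A mA; apply/eqP; rewrite -normr_le0 -m0.
rewrite (le_trans _ (tv_norm_split m mA (measurableC mA) (setUv A) (setICr A)))//.
by rewrite lerDl.
Qed.

HB.instance Definition _ :=
  Lmodule_isNormed.Build R smeas tv_normD tv_normZ tv_norm0_eq0.

Definition smeas_le (m n : smeas) : Prop :=
  forall A, measurable A -> m A <= n A.

Lemma smeas_le_anti m n : smeas_le m n -> smeas_le n m -> m = n.
Proof.
by move=> mn nm; apply: smeas_eqP => A mA; apply/eqP; rewrite eq_le mn// nm.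
Qed.

Lemma smeas_le_trans n m p : smeas_le m n -> smeas_le n p -> smeas_le m p.
Proof. by move=> mn np A mA; rewrite (le_trans (mn A mA))// np. Qed.

Lemma smeas_le_add2r p m n : smeas_le m n -> smeas_le (m + p) (n + p).
Proof. by move=> mn A mA; rewrite lerD// mn. Qed.

Lemma smeas_le_scale a m n : 0 <= a -> smeas_le m n -> smeas_le (a *: m) (a *: n).
Proof. by move=> a0 mn A mA; rewrite ler_wpM2l// mn. Qed.

HB.instance Definition _ := NormedModule_isOrdered.Build R smeas
  (fun m A mA => lexx (m A)) smeas_le_anti smeas_le_trans
  smeas_le_add2r smeas_le_scale.

Definition is_prob (m : smeas) : Prop := 0 ⪯ m /\ m setT = 1.

Record prob := Prob { prob_val :> smeas ; prob_valP : `[< is_prob prob_val >] }.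

HB.instance Definition _ := [isSub for prob_val].
HB.instance Definition _ := [Choice of prob by <:].

Lemma prob_ge0 (f : prob) A : (0 <= (f A)%:E)%E.
Proof.
have /asboolP[f0 _] := prob_valP f; rewrite lee_fin.
have [mA|mA] := pselect (measurable A); first exact: f0.
by have /asboolP[_ _ ->] := smeas_funP f.
Qed.

Definition prob_measure (f : prob) : set T -> \bar R :=
  measure_of_charge (charge_of_smeas f) (prob_ge0 f).

HB.instance Definition _ (f : prob) := Measure.on (prob_measure f).

Lemma prob_measureT (f : prob) : prob_measure f setT = 1%E.
Proof. by have /asboolP[_ f1] := prob_valP f; congr (_%:E). Qed.

HB.instance Definition _ (f : prob) :=
  Measure_isProbability.Build d T R (prob_measure f) (prob_measureT f).

Lemma smeas_of_charge_subproof (nu : {charge set T -> \bar R}) :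
  (fun A => fine (crestr0 nu measurableT A)) \in smeas_pred.
Proof.
have fE A : (fine (crestr0 nu measurableT A))%:E = crestr0 nu measurableT A.
  rewrite fineK// /crestr0; case: ifPn => //; rewrite inE => mA.
  by rewrite /crestr setIT fin_num_measure.
apply/asboolP; split; first by rewrite charge0.
- by rewrite (funext fE); exact: charge_semi_sigma_additive.
- by move=> A mA; rewrite /crestr0 memNset.
Qed.

Definition smeas_of_charge (nu : {charge set T -> \bar R}) : smeas :=
  SMeas (smeas_of_charge_subproof nu).

(* Integral against a signed measure, through its Jordan decomposition. *)
Definition smeas_int (m : smeas) (g : T -> R) : R :=
  Rintegral (pos_part m) setT g - Rintegral (neg_part m) setT g.

End SignedMeasures.
Arguments charge_of_smeas {d T R}.
Arguments smeas_int {d T R}.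
Arguments prob_measure {d T R}.

Section Linf.
Context {d : measure_display} {T : measurableType d} {R : realType}.
Variable mu : {finite_measure set T -> \bar R}.

Definition is_density (f : T -> R) (m : smeas T R) : Prop :=
  forall A, measurable A -> (m A)%:E = (\int[mu]_(x in A) (f x)%:E)%E.

(* [L^\infty(mu)], embedded in the signed measures as densities. *)
Definition linf_pred : {pred smeas T R} := fun m =>
  `[< exists2 f, f \in Lfun mu +oo%E & is_density f m >].

Record linf := LInf { linf_val :> smeas T R ; linf_valP : linf_val \in linf_pred }.

HB.instance Definition _ := [isSub for linf_val].
HB.instance Definition _ := [Choice of linf by <:].

Lemma Lfun_oo_integrable f : f \in Lfun mu +oo%E ->
  mu.-integrable setT (EFin \o f).
Proof.
move=> fL; apply/Lfun1_integrable.
apply: (@Lfun_subset _ _ _ mu 1%E +oo%E) => //; first exact: leey.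
  exact: fin_num_measure.
exact: leey.
Qed.

Lemma is_densityD a f g m n : f \in Lfun mu +oo%E -> g \in Lfun mu +oo%E ->
  is_density f m -> is_density g n -> is_density (a *: f + g) (a *: m + n).
Proof.
move=> /Lfun_oo_integrable If /Lfun_oo_integrable Ig fm gn A mA.
have IfA := integrableS measurableT mA (@subsetT _ _) If.
have IgA := integrableS measurableT mA (@subsetT _ _) Ig.
under eq_integral => x _ do rewrite !fctE EFinD EFinM.
rewrite integralD//; last exact: integrableZl.
by rewrite integralZl// -fm// -gn.
Qed.

Lemma linf_submod : submod_closed linf_pred.
Proof.
have [L0 LD] := Lfun_submod_closed mu (leey 1%:E).
split.
  apply/asboolP; exists 0 => // A mA.
  by rewrite integral0_eq.
move=> a m n /asboolP[f fL fm] /asboolP[g gL gn]; apply/asboolP.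
by exists (a *: f + g); [exact: LD|exact: is_densityD].
Qed.

HB.instance Definition _ :=
  GRing.isSubmodClosed.Build R (smeas T R) linf_pred linf_submod.
HB.instance Definition _ := [SubChoice_isSubLmodule of linf by <:].

Lemma linf_density (m : linf) : exists f, f \in Lfun mu +oo%E /\ is_density f m.
Proof. by have /asboolP[f] := linf_valP m; exists f. Qed.

Definition density (m : linf) : T -> R := projT1 (cid (linf_density m)).

Definition linf_norm (m : linf) : R := fine ('N[mu]_+oo [EFin \o density m])%E.

Lemma densityP (m : linf) : density m \in Lfun mu +oo%E /\ is_density (density m) m.
Proof. exact: (projT2 (cid (linf_density m))). Qed.

Lemma linf_norm_density (m : linf) f : f \in Lfun mu +oo%E -> is_density f m ->
  (linf_norm m)%:E = ('N[mu]_+oo [EFin \o f])%E.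
Proof.
move=> fL fm; have [gL gm] := densityP m.
have -> : linf_norm m = fine ('N[mu]_+oo [EFin \o f])%E.
  rewrite /linf_norm; congr fine; rewrite unlock; case: ifPn => // _.
  apply: eq_ess_sup.
  have : ae_eq mu setT (EFin \o density m) (EFin \o f).
    apply: integral_ae_eq => //.
    - exact: Lfun_oo_integrable.
    - exact: measurable_int (Lfun_oo_integrable fL).
    - by move=> E _ mE; rewrite -gm// -fm.
  by apply: filterS => x /(_ I) /= [->].
rewrite fineK// ge0_fin_numE ?Lnorm_ge0//.
by have /andP[_] := fL; rewrite inE.
Qed.

Lemma linf_normD (m n : linf) : linf_norm (m + n) <= linf_norm m + linf_norm n.
Proof.
have [fL fm] := densityP m; have [gL gn] := densityP n.
have [_ LD] := Lfun_submod_closed mu (leey 1%:E).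
have mnE : is_density (density m + density n) (m + n).
  by have := is_densityD 1 fL gL fm gn; rewrite !scale1r.
have mnL : density m + density n \in Lfun mu +oo%E.
  by have := LD 1 _ _ fL gL; rewrite scale1r.
rewrite -lee_fin EFinD (linf_norm_density (m := m + n) mnL mnE).
rewrite (linf_norm_density fL fm) (linf_norm_density gL gn).
have /andP[/[!inE] mf _] := fL; have /andP[/[!inE] mg _] := gL.
by apply: eminkowski => //; exact: leey.
Qed.

Lemma linf_normZ_le a (m : linf) : linf_norm (a *: m) <= `|a| * linf_norm m.
Proof.
have [fL fm] := densityP m.
have [L0 LD] := Lfun_submod_closed mu (leey 1%:E).
have aE : is_density (a *: density m) (a *: m).
  move=> A mA; have If := Lfun_oo_integrable fL.
  have IfA := integrableS measurableT mA (@subsetT _ _) If.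
  under eq_integral => x _ do rewrite !fctE EFinM.
  by rewrite integralZl// -fm.
have aL : a *: density m \in Lfun mu +oo%E.
  by have := LD a _ _ fL L0; rewrite addr0.
rewrite -lee_fin EFinM (linf_norm_density (m := a *: m) aL aE).
rewrite (linf_norm_density fL fm).
by rewrite -(Lfun_valP (leey 1%:E) fL) LnormZ.
Qed.

Lemma linf_norm_ge0 (m : linf) : 0 <= linf_norm m.
Proof. by rewrite fine_ge0 ?Lnorm_ge0. Qed.

Lemma linf_normZ a (m : linf) : linf_norm (a *: m) = `|a| * linf_norm m.
Proof.
apply/eqP; rewrite eq_le linf_normZ_le/=.
have [->|a0] := eqVneq a 0; first by rewrite normr0 mul0r linf_norm_ge0.
rewrite -ler_pdivlMl ?normr_gt0// -normfV.
by rewrite (le_trans _ (linf_normZ_le _ _))// scalerA mulVf// scale1r.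
Qed.

Lemma linf_norm0_eq0 (m : linf) : linf_norm m = 0 -> m = 0.
Proof.
have [fL fm] := densityP m => m0.
have := @Lnorm_eq0_eq0 _ _ _ mu (EFin \o density m) +oo%E
  (measurable_int _ (Lfun_oo_integrable fL)) (ltry _).
rewrite -(linf_norm_density fL fm) m0 => /(_ erefl) f0.
apply/val_inj/smeas_eqP => A mA; apply: EFin_inj; rewrite fm//.
rewrite (ae_eq_integral (cst 0%E))//; first by rewrite integral0.
  apply: measurable_funS (measurable_int _ (Lfun_oo_integrable fL)) => //.
by apply: filterS f0 => x /= xf _; exact: xf.
Qed.

HB.instance Definition _ :=
  Lmodule_isNormed.Build R linf linf_normD linf_normZ linf_norm0_eq0.

(* The order of the signed measures; on the densities it is the almost everywhere
   order. *)
Definition linf_le (m n : linf) : Prop := (m : smeas T R) ⪯ n.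

Lemma linf_le_anti m n : linf_le m n -> linf_le n m -> m = n.
Proof. by move=> mn nm; apply/val_inj/vle_anti. Qed.

Lemma linf_le_trans n m p : linf_le m n -> linf_le n p -> linf_le m p.
Proof. exact: vle_trans. Qed.

Lemma linf_le_add2r p m n : linf_le m n -> linf_le (m + p) (n + p).
Proof. exact: vle_add2r. Qed.

Lemma linf_le_scale a m n : 0 <= a -> linf_le m n -> linf_le (a *: m) (a *: n).
Proof. exact: vle_scale. Qed.

HB.instance Definition _ := NormedModule_isOrdered.Build R linf
  (fun m => vle_refl (m : smeas T R)) linf_le_anti linf_le_trans
  linf_le_add2r linf_le_scale.

Lemma linf_one_subproof :
  smeas_of_charge (charge_of_finite_measure mu) \in linf_pred.
Proof.
apply/asboolP; exists (cst 1).
  rewrite inE; apply/andP; split; rewrite inE//=.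
  rewrite /finite_norm unlock; case: ifPn => // mu0.
  apply: (@le_lt_trans _ _ 1%E); last exact: ltry.
  by apply/ess_supP; apply/nearW => x; rewrite /= normr1.
move=> A mA; rewrite [RHS](_ : _ = \int[mu]_(x in A) cst 1 x)%E//.
rewrite integral_cst// mul1e /= /crestr0 mem_set// /crestr setIT.
by rewrite fineK// fin_num_measure.
Qed.

(* The order unit of [L^\infty(mu)], i.e. the constant density [1]. *)
Definition linf_one : linf := LInf linf_one_subproof.

End Linf.
Arguments linf {d T R} mu.

(* The point is only needed by [g_sigma_algebraType]. *)
HB.structure Definition PointedMetric (R : realType) :=
  {T of Metric R T & Pointed T}.

Notation borel Omega := (g_sigma_algebraType (@open Omega)).

Section WeakStar.
Context {R : realType}.

Definition wstar (V : normedModType R) : topologicalType :=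
  initial_topology ((fun f => f) : V^dual -> {ptws V -> R^o}).

(* On a compact metric space every finite Borel measure is a Radon measure; the
   weak-* topologies below are those of the duality with [C(Omega)]. *)
Definition radon (Omega : PointedMetric.type R) : orderedNormedModType R :=
  smeas (borel Omega) R.

Definition wstar_radon (Omega : PointedMetric.type R) : topologicalType :=
  initial_topology
    ((fun m g => smeas_int m g) :
       radon Omega -> {ptws continuousType Omega R -> R^o}).

Definition wstar_prob (Omega : PointedMetric.type R) : topologicalType :=
  initial_topology ((@prob_val _ _ _) : prob (borel Omega) R -> wstar_radon Omega).

Definition sequentially_compact (X : topologicalType) (S : set X) : Prop :=
  forall x : nat -> X, (forall n, S (x n)) ->
  exists (k : nat -> nat) (l : X),
    [/\ {homo k : m n / (m < n)%N >-> (m < n)%N}, S l & x \o k @ \oo --> l].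

End WeakStar.

Section ConvexAnalysis.
Context {R : realType}.
Local Open Scope ereal_scope.

Definition edom {V : Type} (F : V -> \bar R) : set V := [set v | F v < +oo].

Definition eproper {V : Type} (F : V -> \bar R) : Prop :=
  edom F !=set0 /\ forall v, F v != -oo.

Definition econvex {V : lmodType R} (F : V -> \bar R) : Prop :=
  forall (t : R) (u v : V), (0 <= t <= 1)%R ->
  F (t *: u + (1 - t) *: v)%R <= t%:E * F u + (1 - t)%:E * F v.

Context {V : normedModType R}.
Implicit Types (J : V -> \bar R) (p q : V^dual) (u w : V).

Definition fconj J p : \bar R := ereal_sup [set (p v)%:E - J v | v in [set: V]].

Definition subdiff J w : set (V^dual) :=
  [set p | J w \is a fin_num /\ forall u, J w + (p (u - w))%:E <= J u].

Definition bregman J p u w : \bar R := J u - J w - (p (u - w))%:E.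

Definition bregman_sym q p u w : R := (q - p)%R (u - w)%R.

End ConvexAnalysis.

Section Divergence.
Context {d : measure_display} {T : measurableType d} {R : realType}.
Variable phi : R -> R.
Local Open Scope ereal_scope.

(* [phi] is given on (0, +oo) only; its value at 0 is the limit from the right,
   which may be infinite. *)
Definition phi0 (y : R) : \bar R :=
  if (0 < y)%R then (phi y)%:E else lim ((phi t)%:E @[t --> (0%R)^'+]).

Definition phi_conj (x : R) : \bar R :=
  ereal_sup [set (x * y - phi y)%:E | y in [set y | (0 < y)%R]].

Local Open Scope charge_scope.

Definition divergence (rho : {charge set T -> \bar R})
    (nu : {sigma_finite_measure set T -> \bar R}) : \bar R :=
  \int[nu]_x phi0 (fine ('d rho '/d nu x)).

Definition Hphi (v : smeas T R) (f : prob T R) : \bar R :=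
  if `[< is_prob v /\ charge_of_smeas v `<< prob_measure f >]
  then divergence (charge_of_smeas v) (prob_measure f) else +oo.

End Divergence.

Section Problem.
Context {R : realType} {X : normedModType R} {Y : orderedNormedModType R}.
Implicit Types (a : R) (h : Y -> \bar R) (J : X -> \bar R) (Al Au : blin X Y).

Definition Bop Al Au : blin X (Y * Y)%type := bpair Al (- Au).

Definition Eop : blin Y (Y * Y)%type := bpair (@bid R Y) (- @bid R Y).

Definition adjoint {Z : normedModType R} (L : blin Z (Y * Y)%type)
    (mu : Y^dual * Y^dual) : Z^dual :=
  bcomp (dual_pair mu) L.

Definition feasible Al Au (u : X) (v : Y) : Prop := Al u ⪯ v /\ v ⪯ Au u.

Definition primal_objective a h J (u : X) (v : Y) : \bar R :=
  ((a^-1)%:E * h v + J u)%E.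

Definition primal_solution a h J Al Au (u : X) (v : Y) : Prop :=
  feasible Al Au u v /\
  forall u' v', feasible Al Au u' v' ->
    (primal_objective a h J u v <= primal_objective a h J u' v')%E.

Definition pair_ge0 (mu : Y^dual * Y^dual) : Prop :=
  dual_ge0 mu.1 /\ dual_ge0 mu.2.

Definition dual_objective a h J Al Au (mu : Y^dual * Y^dual) : \bar R :=
  (- ((a^-1)%:E * fconj h (a *: adjoint Eop mu)%R)
   - fconj J (- adjoint (Bop Al Au) mu)%R)%E.

Definition dual_solution a h J Al Au (mu : Y^dual * Y^dual) : Prop :=
  pair_ge0 mu /\
  forall nu, pair_ge0 nu ->
    (dual_objective a h J Al Au nu <= dual_objective a h J Al Au mu)%E.

End Problem.

Section Rates.
Context {R : realType}.
Local Open Scope ereal_scope.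

Definition ereal_bigO (a b : nat -> \bar R) : Prop :=
  exists2 C : R, (0 < C)%R & \forall n \near \oo, `|a n| <= C%:E * b n.

Definition rate (r : R -> \bar R) (delta alpha eta : nat -> R) (K : R)
    (n : nat) : \bar R :=
  (delta n / alpha n)%:E + r (K * alpha n)%R * ((alpha n)^-1)%:E + (eta n)%:E.

(* [a] is O(delta/alpha + r(alpha)/alpha + eta), where [g] is the function whose
   multiples [alpha * g] the remainder [r] is applied to. A factor inside of [r]
   cannot always be absorbed into the constant of the O, e.g. if r(x) is
   exp(-1/|x|) near 0. The remainder is therefore evaluated at [K * alpha] with
   [K] a bound on the oscillation of [g], hence at [alpha] if this oscillation is
   at most 1; it is also evaluated at [alpha], for any [g], if [r] is doubling. *)
Definition rate_bound {T : Type} (g : T -> R) (r : R -> \bar R)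
    (delta alpha eta : nat -> R) (a : nat -> \bar R) : Prop :=
  (forall K : R, (forall x y, (g x - g y <= K)%R) ->
    ereal_bigO a (rate r delta alpha eta K)) /\
  ((exists c : R, \forall x \near (0%R)^'+, r (2 * x)%R <= c%:E * r x) ->
    ereal_bigO a (rate r delta alpha eta 1)).

End Rates.

(* Main.v *)
Require Import Defs.
From HB Require Import structures.
From mathcomp Require Import all_boot all_order all_algebra.
From mathcomp Require Import all_classical all_reals all_analysis.
From mathcomp Require Import measurable_realfun ess_sup_inf.
From mathcomp Require Import ring lra.

Set Implicit Arguments.
Unset Strict Implicit.
Unset Printing Implicit Defensive.

Import Order.TTheory GRing.Theory Num.Def Num.Theory.
Import numFieldNormedType.Exports.

Local Open Scope classical_set_scope.
Local Open Scope ring_scope.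

(** Write [G w] for the integral of [g] against [w], so that
[- <pdag, w - udag> = G (A w) - G fbar], and [H] for the fidelity of [v_n] with
respect to [f_n]. Since [udag] is positive, the pair [(udag, fbar)] is feasible
and minimality of [(u_n, v_n)] gives
[J u_n - J udag <= (delta_n - H) / alpha_n]. Hence the Bregman distance is at
most the excess
[(delta_n - H) / alpha_n + G (A u_n - v_n) + G (v_n - fbar)].

- The middle term is of order [eta_n |u_n|]. As [u_n] need not be positive, the
  order bounds on [A] are first applied to two positive functionals with
  difference [u_n], which Hahn-Banach provides ([dual_pos_majorant],
  [bracket_error]). The norm of [u_n] grows at most like [1 + delta_n / alpha_n],
  because [J] is convex with bounded sublevel sets
  ([wstar_sequentially_compact_bounded], [econvex_coercive]).
- For the last term, [v_n] and [fbar] are probability measures, so constants may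
  be added to [g], which may thus be assumed to take values in [[0, K]] with [K]
  a bound on its oscillation. The Fenchel-Young inequality
  [t y <= phi y + t + r t] for [t = alpha_n g x] and [y] the density of [v_n]
  with respect to [f_n], integrated against [f_n], bounds
  [alpha_n G (v_n - f_n)] by [H + r (K alpha_n)]. Applied to [- g] and the
  density of [fbar], it bounds [alpha_n G (f_n - fbar)] by
  [delta_n + r (K alpha_n)] ([divergence_young], [divergence_oscillation]).
  The fidelity [H] cancels.

This is [excess_bigO]. For the symmetric distance, strict feasibility yields
multipliers without duality gap ([lagrange_multiplier], [slater_saddle]), so
every dual solution is the multiplier of a saddle point
([dual_solution_saddle]). Complementary slackness and the fact that
[alpha_n E^T mu_n] is a subgradient of the fidelity at [v_n] give
[<p_n, u_n - udag> <= (delta_n - H) / alpha_n] ([saddle_subgradient_le]), which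
is the bound that [J u_n - J udag] satisfies. The symmetric distance therefore
has the same excess as upper bound. *)

(** * The Hahn-Banach theorem *)

Section HahnBanach.
Context {R : realType} {V : lmodType R}.

(** A sublinear functional, encoded as a cone of pairs of a point and an upper
bound for its value there; this spares the applications all infima. *)
Definition epi_cone (C : set (V * R)) : Prop :=
  [/\ forall x c y d, C (x, c) -> C (y, d) -> C (x + y, c + d),
      forall t x c, 0 < t -> C (x, c) -> C (t *: x, t * c)
    & forall c, C (0, c) -> 0 <= c].

(** The conditions involve at most two elements at a time, so unions of chains
preserve them, and Zorn's lemma replaces the usual extension by one dimension at a
time. *)
Lemma epi_cone_maximal (C : set (V * R)) : epi_cone C ->
  exists D, [/\ C `<=` D, epi_cone D &
    forall D', D `<=` D' -> epi_cone D' -> D' `<=` D].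
Proof.
move=> coneC; pose P (B : set (V * R)) := epi_cone (C `|` B).
have [F FP totF|B [PB maxB]] := @Zorn_bigcup _ P.
  have [[X0 FX0]|F0] := pselect (F !=set0); last first.
    rewrite (_ : \bigcup_(X in F) X = set0); first by rewrite /P setU0.
    by rewrite -subset0 => z [X FX _]; apply: F0; exists X.
  have wit a b : (C `|` \bigcup_(X in F) X) a -> (C `|` \bigcup_(X in F) X) b ->
      exists X, [/\ F X, (C `|` X) a & (C `|` X) b].
    move=> [Ca|[X FX Xa]] [Cb|[Y FY Yb]].
    - by exists X0; split => //; left.
    - by exists Y; split => //; [left|right].
    - by exists X; split => //; [right|left].
    - have [XY|YX] := totF _ _ FX FY.
        by exists Y; split => //; right => //; exact: XY.
      by exists X; split => //; right => //; exact: YX.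
  have up X a : F X -> (C `|` X) a -> (C `|` \bigcup_(X in F) X) a.
    by move=> FX [Ca|Xa]; [left|right; exists X].
  split.
  - move=> x c y d /wit /[apply] -[X [FX Xa Xb]].
    by apply: (up X) => //; have [+ _ _] := FP _ FX; exact.
  - move=> t x c t0 Ca; have [X [FX Xa _]] := wit _ _ Ca Ca.
    by apply: (up X) => //; have [_ + _] := FP _ FX; exact.
  - move=> c Ca; have [X [FX Xa _]] := wit _ _ Ca Ca.
    by have [_ _] := FP _ FX; exact.
exists (C `|` B); split => // D' CBD' coneD'.
have CD' : C `|` D' = D'.
  by apply/setUidPr => z Cz; apply: CBD'; left.
move=> z D'z; apply: contrapT => Bz; apply: (maxB D'); last by rewrite /P CD'.
split; last by move=> D'B; apply: Bz; right; exact: D'B.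
by move=> w Bw; apply: CBD'; right.
Qed.

(** A maximal cone contains every ray that does not make it improper, and this
turns the sublinear functional that it bounds into an odd, hence linear, one. *)
Lemma hahn_banach (C : set (V * R)) : epi_cone C ->
  (forall x, exists c, C (x, c)) ->
  exists l : V -> R, linear (l : V -> R^o) /\ forall x c, C (x, c) -> l x <= c.
Proof.
move=> /epi_cone_maximal[D [CD [addD scaleD D0] maxD]] Cne.
have Dne x : exists c, D (x, c) by have [c /CD] := Cne x; exists c.
pose l x := inf [set c | D (x, c)].
have Dlb x d : D (- x, d) -> lbound [set c | D (x, c)] (- d).
  move=> Dd c /= Dc; rewrite lerNl -subr_ge0 opprK; apply: D0.
  by rewrite -(addNr x); exact: addD.
have Dhas x : has_lbound [set c | D (x, c)].
  by have [d /Dlb] := Dne (- x); exists (- d).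
have l_le x c : D (x, c) -> l x <= c by move=> Dc; exact: ge_inf.
have attained y : D (y, - l (- y)).
  (* [D] enlarged by the ray through the point to be shown in [D] *)
  pose D' : set (V * R) := [set z | exists s x c,
    [/\ 0 <= s, D (x, c) & z = (x + s *: y, c - s * l (- y))]].
  apply: (maxD D').
  - by move=> [x c] Dxc; exists 0, x, c; rewrite scale0r mul0r addr0 subr0.
  - split.
    + move=> _ _ _ _ [s [x [c [s0 Dxc [-> ->]]]]] [s' [x' [c' [s0' Dxc' [-> ->]]]]].
      exists (s + s'), (x + x'), (c + c'); split; [exact: addr_ge0|exact: addD|].
      by rewrite scalerDl mulrDl opprD addrACA [c - _ + _]addrACA.
    + move=> t _ _ t0 [s [x [c [s0 Dxc [-> ->]]]]].
      exists (t * s), (t *: x), (t * c); split; [|exact: scaleD|].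
        by rewrite mulr_ge0// ltW.
      by rewrite scalerDr scalerA mulrBr mulrA.
    + move=> _ [s [x [c [s0 Dxc [/esym/eqP + ->]]]]].
      rewrite addr_eq0 => /eqP xE; rewrite subr_ge0.
      move: s0; rewrite le_eqVlt => /predU1P[s0|s0].
        by move: Dxc; rewrite xE -s0 mul0r scale0r oppr0; exact: D0.
      rewrite -ler_pdivlMl//; apply: l_le.
      suff -> : - y = s^-1 *: x by apply: scaleD => //; rewrite invr_gt0.
      by rewrite xE scalerN scalerA mulVf ?scale1r ?gt_eqF.
  - have [c Dc] := Dne 0; exists 1, 0, 0; split => //; last first.
      by rewrite scale1r mul1r !add0r.
    (* the origin lies in [D] because adding [(0, 0)] keeps it a proper cone *)
    apply: (maxD (D `|` [set (0, 0)])); [by left| |by right].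
    split.
    + move=> x c1 y' d [Dx|[-> ->]] [Dy|[-> ->]]; rewrite ?add0r ?addr0.
      * by left; exact: addD.
      * by left.
      * by left.
      * by right.
    + move=> t x c1 t0 [Dx|[-> ->]]; first by left; exact: scaleD.
      by right; rewrite scaler0 mulr0.
    + by move=> c1 [/D0//|[->]].
have lN x : l (- x) = - l x.
  apply/eqP; rewrite eq_le; apply/andP; split.
    by rewrite lerNr; apply: l_le; exact: attained.
  apply: lb_le_inf; first by have [c] := Dne (- x); exists c.
  move=> c Dc; rewrite lerNl; apply: lb_le_inf; first exact: Dne.
  by move=> d; exact: Dlb.
have Dl x : D (x, l x) by rewrite -[l x]opprK -lN; exact: attained.
have lD x y : l (x + y) = l x + l y.
  apply/eqP; rewrite eq_le l_le; last exact: addD.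
  rewrite -lerN2 opprD -!lN opprD; apply: l_le; exact: addD.
have lZ t x : 0 < t -> l (t *: x) = t * l x.
  move=> t0; apply/eqP; rewrite eq_le l_le; last exact: scaleD.
  rewrite -ler_pdivlMl// mulrC.
  rewrite -{1}(scale1r x) -(mulVf (lt0r_neq0 t0)) -scalerA mulrC.
  by apply: l_le; apply: scaleD; rewrite ?invr_gt0.
have l0 : l 0 = 0.
  by apply: (@addIr _ (l 0)); rewrite -lD addr0 add0r.
exists l; split => [t x y|x c /CD]; last exact: l_le.
rewrite lD; congr (_ + _).
have [t0|t0|->] := ltgtP t 0; last by rewrite !scale0r l0.
  by rewrite -[t]opprK scaleNr lN lZ ?oppr_gt0// scaleNr.
exact: lZ.
Qed.

End HahnBanach.

(** * Positive majorants in the dual of a Banach lattice *)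

Lemma norm_le_pos {R : realType} {U : banachLatticeType R} (x y : U) :
  0 ⪯ x -> x ⪯ y -> `|x| <= `|y|.
Proof.
move=> x0 xy; apply: vlattice_norm.
have [y_le _] := (vjoinP y (- y) (vjoin y (- y))).1 (vle_refl _).
have xz : x ⪯ vjoin y (- y) by apply: vle_trans xy y_le.
apply/vjoinP; split => //; apply: vle_trans (_ : 0 ⪯ _); last first.
  by apply: vle_trans x0 xz.
by have := vle_add2r (- x) _ _ x0; rewrite add0r subrr.
Qed.

Lemma vle0D {R : realType} {V : orderedNormedModType R} (x y : V) :
  0 ⪯ x -> 0 ⪯ y -> 0 ⪯ x + y.
Proof.
move=> x0 y0; apply: (vle_trans _ _ _ y0).
by have := vle_add2r y _ _ x0; rewrite add0r.
Qed.

Lemma vle0Z {R : realType} {V : orderedNormedModType R} (t : R) (x : V) :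
  0 <= t -> 0 ⪯ x -> 0 ⪯ t *: x.
Proof. by move=> t0 /(vle_scale _ _ _ t0); rewrite scaler0. Qed.

Lemma vsubr_ge0 {R : realType} {V : orderedNormedModType R} (x y : V) :
  (0 ⪯ y - x) = (x ⪯ y).
Proof.
apply/propext; split=> [/(vle_add2r x _ _)|/(vle_add2r (- x) _ _)].
  by rewrite add0r subrK.
by rewrite subrr.
Qed.

(** A linear functional below [x |-> inf_(y, z >= 0) |u| |x + y + z| - u y] is
positive (take [x = - z]), dominates [u] on the positive cone (take [x = - y])
and has norm at most [|u|]. The infimum is finite because the norm is monotone
on the positive cone. This replaces the positive part of [u], of which only
these three properties matter. *)
Lemma dual_pos_majorant {R : realType} {U : banachLatticeType R} (u : U^dual) :
  exists w : U^dual, [/\ dual_ge0 w, dual_ge0 (w - u) & `|w| <= `|u|].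
Proof.
pose C : set (U * R) := [set xc | exists y z,
  [/\ 0 ⪯ y, 0 ⪯ z & `|u| * `|xc.1 + y + z| - u y <= xc.2]].
have le0 := @vle_refl R U 0.
have [||l [linl lC]] := @hahn_banach R U C.
- split.
  + move=> x c x' c' [y [z /= [y0 z0 yz]]] [y' [z' /= [y0' z0' yz']]].
    exists (y + y'), (z + z'); split; [exact: vle0D|exact: vle0D|].
    apply: le_trans (lerD yz yz'); rewrite linearD/=.
    rewrite [leRHS]addrACA -mulrDr -opprD lerD2r ler_wpM2l//.
    by rewrite (addrACA x) (addrACA (x + y)) ler_normD.
  + move=> t x c t0 [y [z /= [y0 z0 yz]]].
    exists (t *: y), (t *: z); split; [exact/vle0Z/y0/ltW|exact/vle0Z/z0/ltW|].
    rewrite /= -!scalerDr normrZ gtr0_norm// linearZ/=.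
    by rewrite mulrCA -mulrBr ler_pM2l.
  + move=> c [y [z /= [y0 z0]]]; rewrite add0r; apply: le_trans.
    rewrite subr_ge0 (le_trans (ler_norm _))// (le_trans (opnormP _ _))//.
    rewrite ler_wpM2l ?opnorm_ge0//; apply: norm_le_pos y0 _.
    by rewrite -vsubr_ge0 addrAC subrr add0r.
- by move=> x; exists (`|u| * `|x|), 0, 0; rewrite /= linear0 subr0 !addr0.
have l_le x : l x <= `|u| * `|x|.
  by apply: lC; exists 0, 0; rewrite /= linear0 subr0 !addr0.
pose lP : {linear U -> R^o} := HB.pack l (GRing.isLinear.Build _ _ _ _ _ linl).
have l_norm x : `|l x| <= `|u| * `|x|.
  rewrite ler_norml l_le andbT lerNl -normrN.
  by rewrite -[l x]/(lP x) -linearN; exact: l_le.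
have lin : (l : U -> R^o) \in blin_pred U R^o.
  by apply/asboolP; split => //; exists `|u|.
exists (BLin lin); split.
- move=> x x0 /=; rewrite -oppr_le0 -[l x]/(lP x) -linearN; apply: lC.
  by exists 0, x; rewrite /= linear0 subr0 addr0 addNr normr0 mulr0.
- move=> x x0; rewrite /= !fctE /= subr_ge0 -lerN2.
  rewrite -[l x]/(lP x) -linearN; apply: lC.
  by exists x, 0; rewrite /= addNr addr0 normr0 mulr0 add0r.
- by apply: opnorm_le => x x1; rewrite (le_trans (l_norm x))// ler_piMr.
Qed.

(** * Multipliers under a Slater condition *)

(** The multiplier is minus a linear minorant of the directional derivative at 0
of the optimal value as a function of the perturbation of the constraint. The
cone generated by the perturbed problems is proper because [P] is a lower bound
for the unperturbed one, and it has an upper bound over each direction because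
the Slater point remains feasible under small perturbations. *)
Lemma lagrange_multiplier {R : realType} (W : lmodType R) (Z : normedModType R)
    (K : set Z) (F : W -> \bar R) (G : {linear W -> Z}) (P rho : R) (w0 : W) :
  K 0 -> (forall z z', K z -> K z' -> K (z + z')) ->
  (forall (t : R) z, 0 < t -> K z -> K (t *: z)) -> econvex F ->
  (forall w, K (- G w) -> (P%:E <= F w)%E) ->
  0 < rho -> (F w0 < +oo)%E -> (forall z, `|z| <= rho -> K (z - G w0)) ->
  exists l : Z^dual, (forall z, K z -> 0 <= l z) /\
    forall w, (P%:E <= F w + (l (G w))%:E)%E.
Proof.
move=> K0 KD KZ Fcvx PF rho0 Fw0 slater.
have [d0 Fd0] : exists d0 : R, (F w0 <= d0%:E)%E.
  case: (F w0) Fw0 => [d _||_]; [by exists d|by rewrite ltxx|].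
  by exists 0; exact: leNye.
pose C : set (Z * R) := [set zc | exists (s : R) w k d,
  [/\ 0 < s, K k, (F w <= d%:E)%E & zc = (s *: (G w + k), s * (d - P))]].
have [||l [linl lC]] := @hahn_banach R Z C.
- split.
  + move=> x c x' c' [s [w [k [d [s0 Kk Fd [-> ->]]]]]].
    move=> [s' [w' [k' [d' [s0' Kk' Fd' [-> ->]]]]]].
    have ss0 : 0 < s + s' by rewrite addr_gt0.
    have [t [t0 t1 ts ts']] : exists t : R,
        [/\ 0 < t, 0 < 1 - t, (s + s') * t = s & (s + s') * (1 - t) = s'].
      have t1E : 1 - s / (s + s') = s' / (s + s') by field; rewrite gt_eqF.
      exists (s / (s + s')); rewrite t1E !divr_gt0//.
      by split => //; field; rewrite gt_eqF.
    exists (s + s'), (t *: w + (1 - t) *: w'), (t *: k + (1 - t) *: k').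
    exists (t * d + (1 - t) * d'); split => //.
    * by apply: KD; exact: KZ.
    * apply: (le_trans (Fcvx _ _ _ _)); first by rewrite ltW//= -subr_ge0 ltW.
      by rewrite (EFinD (t * d)) !EFinM leeD// lee_pmul2l ?lte_fin.
    * congr pair.
        rewrite (linearD G) !linearZ_LR/= addrACA -!scalerDr.
        by rewrite [RHS]scalerDr !scalerA ts ts'.
      by rewrite -[s in s * (d - P)]ts -[s' in s' * (d' - P)]ts'; ring.
  + move=> t _ _ t0 [s [w [k [d [s0 Kk Fd [-> ->]]]]]].
    exists (t * s), w, k, d; split => //; first exact: mulr_gt0.
    by rewrite scalerA mulrA.
  + move=> _ [s [w [k [d [s0 Kk Fd [/esym/eqP + ->]]]]]].
    rewrite scaler_eq0 gt_eqF//= addrC addr_eq0 => /eqP kE.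
    apply: mulr_ge0; first exact: ltW.
    by rewrite subr_ge0 -lee_fin (le_trans _ Fd)// PF// -kE.
- move=> z; pose s := `|z| / rho + 1.
  have s0 : 0 < s by rewrite ltr_wpDl// divr_ge0// ltW.
  exists (s * (d0 - P)), s, w0, (s^-1 *: z - G w0), d0; split => //.
    apply: slater; rewrite normrZ gtr0_norm ?invr_gt0// ler_pdivrMl//.
    by rewrite mulrDl mul1r divfK ?gt_eqF// lerDl ltW.
  by rewrite (addrC (G w0)) subrK scalerA mulfV ?scale1r// gt_eqF.
pose lP : {linear Z -> R^o} := HB.pack l (GRing.isLinear.Build _ _ _ _ _ linl).
have lGk w k d : K k -> (F w <= d%:E)%E -> l (G w + k) <= d - P.
  move=> Kk Fd; apply: lC; exists 1, w, k, d.
  by split => //; rewrite scale1r mul1r.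
have l_ball z : `|z| <= rho -> l z <= d0 - P.
  move=> zrho; have := lGk w0 _ _ (slater z zrho) Fd0.
  by rewrite addrC subrK.
have d0P : 0 <= d0 - P.
  by have := l_ball 0; rewrite normr0 -[l 0]/(lP 0) linear0; apply; exact: ltW.
have l_le z : l z <= (d0 - P) / rho * `|z|.
  have [->|z0] := eqVneq z 0.
    by rewrite -[l 0]/(lP 0) linear0 normr0 mulr0.
  have zgt0 : 0 < `|z| by rewrite normr_gt0.
  have := l_ball ((rho / `|z|) *: z).
  rewrite normrZ gtr0_norm ?divr_gt0// divfK ?gt_eqF// => /(_ (lexx _)).
  rewrite -[l _]/(lP _) linearZ/= -ler_pdivlMl ?divr_gt0//.
  by move/le_trans; apply; rewrite le_eqVlt; apply/orP; left; apply/eqP;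
    field; rewrite !gt_eqF.
have l_le0 z : K z -> l z <= 0.
  move=> Kz; have KG : K (- G w0).
    by have := slater 0; rewrite normr0 add0r; apply; exact: ltW.
  have tl t : 0 < t -> t * l z <= d0 - P.
    move=> t0; have := lGk w0 (- G w0 + t *: z) _ _ Fd0.
    rewrite addrA subrr add0r => /(_ (KD _ _ KG (KZ _ _ t0 Kz))).
    by rewrite -[l (t *: z)]/(lP (t *: z)) linearZ.
  rewrite leNgt; apply/negP => lz0.
  have t0 : 0 < (d0 - P + 1) / l z by rewrite divr_gt0// ltr_wpDl.
  by have := tl _ t0; rewrite divfK ?gt_eqF// gerDl ler10.
have lin : ((fun z => - l z) : Z -> R^o) \in blin_pred Z R^o.
  apply/asboolP; split.
    by move=> t x y; rewrite linl opprD scalerN.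
  exists ((d0 - P) / rho) => z; rewrite normrN ler_norml l_le andbT lerNl -normrN.
  by rewrite -[l z]/(lP z) -linearN; exact: l_le.
exists (BLin lin); split => [z /l_le0|w]; first by rewrite /= oppr_ge0.
rewrite /=; have lGw d : (F w <= d%:E)%E -> l (G w) <= d - P.
  by rewrite -[G w]addr0; exact: lGk.
case: (F w) lGw => [d| |] lGw.
- by rewrite -EFinD lee_fin lerBrDl -lerBrDr; exact: lGw.
- by rewrite addye ?leey.
- have := lGw (l (G w) + P - 1) (leNye _).
  by rewrite addrAC addrK lerDl oppr_ge0 ler10.
Qed.

(** * Coercivity of a functional with weak-* sequentially compact sublevel sets *)

(** A weak-* convergent sequence is bounded by the uniform boundedness principle,
so a set that is not bounded has a sequence without convergent subsequences. *)
Lemma wstar_sequentially_compact_bounded {R : realType}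
    (U : completeNormedModType R) (S : set (U^dual)) :
  @sequentially_compact (wstar U) S ->
  exists M : R, forall u : U^dual, S u -> `|u| <= M.
Proof.
move=> Scompact; apply: contrapT => unbounded.
have big n : exists u : U^dual, S u /\ n%:R < `|u|.
  apply: contrapT => small; apply: unbounded; exists n%:R => u Su.
  by rewrite leNgt; apply/negP => nu; apply: small; exists u.
pose x n : U^dual := sval (cid (big n)).
have [Sx xn] : (forall n, S (x n)) /\ forall n, n%:R < `|x n|.
  by split => n; rewrite /x; case: cid => u [].
have [k [l [k_incr _ xl]]] := Scompact (x : nat -> wstar U) Sx.
have k_ge n : (n <= k n)%N.
  by elim: n => // n /leq_ltn_trans; apply; exact: k_incr.
have xkl y : (fun n => x (k n) y : R^o) @ \oo --> (l : U^dual) y.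
  have ev : continuous ((fun u : U^dual => u y) : wstar U -> R^o).
    pose emb : U^dual -> {ptws U -> R^o} := fun f => f.
    have c0 : continuous (emb : wstar U -> _) by exact: initial_continuous.
    have c1 := @proj_continuous U (fun=> R^o) y.
    move=> u. exact: (continuous_comp (c0 u) (c1 _)).
  exact: (cvg_comp _ _ xl (ev l)).
pose F : set (U -> R^o) := [set (x (k n) : U -> R^o) | n in setT].
have F_lin : forall f, F f -> bounded_fun_norm f /\ linear f.
  move=> _ [n _ <-]; split; last exact: blin_linear.
  move=> r; exists (opnorm (x (k n)) * r) => z zr.
  by rewrite (le_trans (opnormP _ _))// ler_wpM2l// opnorm_ge0.
have F_bnd : pointwise_bounded F.
  move=> y; have xy : cvgn (fun n => x (k n) y : R^o).
    by apply/cvg_ex; exists ((l : U^dual) y); exact: xkl.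
  have [M _ yM] := pinfty_ex_gt0 (cvg_seq_bounded xy).
  by exists M => _ [n _ <-]; exact: yM.
have [M xM] := Banach_Steinhauss F_lin F_bnd 1.
have xkM n : `|x (k n)| <= M.
  by apply: opnorm_le => z z1; apply: xM => //; exists n.
pose N := (truncn M).+1.
have : N%:R < M.
  rewrite (lt_le_trans _ (xkM N))// (le_lt_trans _ (xn _))// ler_nat.
  exact: k_ge.
by apply/negP; rewrite -leNgt ltW// truncnS_gt.
Qed.

(** Shrinking [u] towards the base point [w] until [J] exceeds [J w] by at most
1 gives a point of a bounded sublevel set. *)
Lemma econvex_coercive {R : realType} {V : normedModType R} (J : V -> \bar R)
    (w : V) (M : R) : econvex J -> J w \is a fin_num ->
  (forall u, (J u <= J w + 1%:E)%E -> `|u| <= M) ->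
  forall u (t : R), 0 <= t -> (J u <= J w + t%:E)%E -> `|u| <= 2 * M * (1 + t).
Proof.
move=> Jcvx Jw JM u t t0 Jut.
have wM : `|w| <= M by apply: JM; rewrite leeDl// lee_fin.
have t1 : 0 < 1 + t by rewrite ltr_wpDr.
pose s := (1 + t)^-1; have s0 : 0 < s by rewrite invr_gt0.
have s1 : s <= 1 by rewrite invf_le1// lerDl.
have st : s * t <= 1 by rewrite mulrC ler_pdivrMr// mul1r lerDr.
have : `|s *: u + (1 - s) *: w| <= M.
  apply: JM; apply: (le_trans (Jcvx s u w _)); first by rewrite s1 ltW.
  have : (s%:E * J u <= s%:E * (J w + t%:E))%E by rewrite lee_pmul2l.
  case: (J w) Jw => // j _; rewrite -!EFinD -!EFinM => Ju.
  apply: (le_trans (leeD2r _ Ju)).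
  rewrite -!EFinD lee_fin (_ : _ + _ = j + s * t); first by rewrite lerD2l.
  by ring.
move=> zM; rewrite (_ : u = (1 + t) *: ((s *: u + (1 - s) *: w) - (1 - s) *: w)); last first.
  by rewrite addrK scalerA mulfV ?scale1r// gt_eqF.
rewrite normrZ gtr0_norm// mulrC ler_pM2r//.
rewrite (le_trans (ler_normB _ _))// mulr_natl mulr2n lerD//.
rewrite normrZ ger0_norm ?subr_ge0// (le_trans _ wM)// ler_piMl//.
by rewrite gerBl ltW.
Qed.

(** * Duality for the regularized problem *)

Section Duality.
Context {R : realType} {X : normedModType R} {Y : orderedNormedModType R}.
Variables (a : R) (h : Y -> \bar R) (J : X -> \bar R) (Al Au : blin X Y).
Hypotheses (a_gt0 : 0 < a) (h_ge0 : forall v, (0 <= h v)%E)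
  (J_ge0 : forall u, (0 <= J u)%E).
Local Open Scope ereal_scope.

Definition lagrangian (u : X) (v : Y) (mu : Y^dual * Y^dual) : \bar R :=
  primal_objective a h J u v + (mu.1 (Al u - v)%R + mu.2 (v - Au u)%R)%:E.

Lemma adjoint_EopE (mu : Y^dual * Y^dual) (v : Y) (b : R) :
  ((b *: adjoint Eop mu) v = b * (mu.1 v - mu.2 v))%R.
Proof.
by transitivity (b * (mu.1 v + mu.2 (- v)))%R => //; rewrite linearN.
Qed.

Lemma adjoint_BopE (mu : Y^dual * Y^dual) (u : X) :
  ((- adjoint (Bop Al Au) mu) u = mu.2 (Au u) - mu.1 (Al u))%R.
Proof.
transitivity (- (mu.1 (Al u) + mu.2 (- Au u)))%R => //.
by rewrite linearN opprD opprK addrC.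
Qed.

(** Weak duality: the Fenchel inequalities for [h] and [J] add up to this bound. *)
Lemma dual_objective_le_lagrangian mu u v :
  dual_objective a h J Al Au mu <= lagrangian u v mu.
Proof.
rewrite /lagrangian /primal_objective /dual_objective.
have [hv|hv] := eqVneq (h v) +oo.
  rewrite hv gt0_muley ?lte_fin ?invr_gt0//.
  rewrite addye ?addye ?leey//; first by rewrite gt_eqF// (lt_le_trans _ (J_ge0 _)).
have [Ju|Ju] := eqVneq (J u) +oo.
  rewrite Ju addey ?addye ?leey// gt_eqF// (lt_le_trans (ltNye 0%R))//.
  by rewrite mule_ge0// lee_fin invr_ge0 ltW.
have /fineK <- : h v \is a fin_num by rewrite ge0_fin_numE// ltey.
have /fineK <- : J u \is a fin_num by rewrite ge0_fin_numE// ltey.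
set hv' := fine (h v); set ju := fine (J u).
have hF : ((a * (mu.1 v - mu.2 v) - hv')%:E <= fconj h (a *: adjoint Eop mu)%R)%E.
  apply: ereal_sup_ubound; exists v => //.
  by rewrite adjoint_EopE [RHS]EFinB /hv' fineK// ge0_fin_numE// ltey.
have jF : ((mu.2 (Au u) - mu.1 (Al u) - ju)%:E <=
    fconj J (- adjoint (Bop Al Au) mu)%R)%E.
  apply: ereal_sup_ubound; exists u => //.
  by rewrite adjoint_BopE [RHS]EFinB /ju fineK// ge0_fin_numE// ltey.
apply: (@le_trans _ _ (- (a^-1 * (a * (mu.1 v - mu.2 v) - hv'))%:E
    - (mu.2 (Au u) - mu.1 (Al u) - ju)%:E)).
  by rewrite leeD// leeN2// EFinM lee_pmul2l// ?lte_fin ?invr_gt0.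
rewrite -!EFinM -!EFinN -!EFinD lee_fin !linearB/=.
by rewrite le_eqVlt; apply/orP; left; apply/eqP; field; rewrite gt_eqF.
Qed.

(** The Lagrangian is the sum of a function of [u'] and a function of [v'], so its
infimum splits into two separate ones, which are minus the two conjugates. The
points [u] and [v] of the domains keep the conjugates off [-oo]. *)
Lemma le_dual_objective mu u v (P : R) : J u \is a fin_num -> h v \is a fin_num ->
  (forall u' v', P%:E <= lagrangian u' v' mu) ->
  P%:E <= dual_objective a h J Al Au mu.
Proof.
move=> Ju hv PL.
set FJ := fconj J (- adjoint (Bop Al Au) mu)%R.
have PLfin u' v' : J u' \is a fin_num -> h v' \is a fin_num ->
    (P <= a^-1 * fine (h v') + fine (J u')
      + (mu.1 (Al u') - mu.1 v' + (mu.2 v' - mu.2 (Au u'))))%R.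
  move=> Ju' hv'; have := PL u' v'.
  rewrite /lagrangian /primal_objective -(fineK Ju') -(fineK hv').
  by rewrite -EFinM -!EFinD lee_fin !linearB.
have FJ_le v' : h v' \is a fin_num ->
    FJ <= (a^-1 * fine (h v') - (mu.1 v' - mu.2 v') - P)%:E.
  move=> hv'; apply: ge_ereal_sup => _ [u' _ <-].
  rewrite adjoint_BopE.
  have [->|Ju'] := eqVneq (J u') +oo; first by rewrite addeNy// leNye.
  have {}Ju' : J u' \is a fin_num by rewrite ge0_fin_numE// ltey.
  have := PLfin u' v' Ju' hv'; rewrite -(fineK Ju') -EFinB lee_fin; lra.
have FJfin : FJ \is a fin_num.
  rewrite fin_numElt (le_lt_trans (FJ_le v hv)) ?ltry// andbT.
  rewrite (@lt_le_trans _ _ ((- adjoint (Bop Al Au) mu) u - fine (J u))%:E)//.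
    exact: ltNyr.
  by apply: ereal_sup_ubound; exists u => //; rewrite EFinB fineK.
rewrite /dual_objective -/FJ.
have Fh_le : fconj h (a *: adjoint Eop mu)%R <= (a * (- P - fine FJ))%:E.
  apply: ge_ereal_sup => _ [v' _ <-].
  rewrite adjoint_EopE.
  have [->|hv'] := eqVneq (h v') +oo; first by rewrite addeNy// leNye.
  have {}hv' : h v' \is a fin_num by rewrite ge0_fin_numE// ltey.
  have := FJ_le v' hv'; rewrite -(fineK FJfin) -(fineK hv') -EFinB !lee_fin/=.
  move=> H; rewrite -ler_pdivrMl// mulrBr mulrA mulVf ?gt_eqF// mul1r; lra.
apply: (@le_trans _ _ (- (a^-1 * (a * (- P - fine FJ)))%:E - (fine FJ)%:E)).
  rewrite -EFinN -EFinB lee_fin mulrA mulVf ?gt_eqF// mul1r; lra.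
rewrite (fineK FJfin) leeD2r// leeN2// EFinM lee_pmul2l//.
by rewrite lte_fin invr_gt0.
Qed.

Variables (u : X) (v : Y).
Hypothesis uv_sol : primal_solution a h J Al Au u v.
Hypotheses (Ju : J u \is a fin_num) (hv : h v \is a fin_num).

Definition saddle (mu : Y^dual * Y^dual) : Prop :=
  forall u' v', primal_objective a h J u v <= lagrangian u' v' mu.

Lemma lagrangian_le_primal mu : pair_ge0 mu ->
  lagrangian u v mu <= primal_objective a h J u v.
Proof.
move=> [mu1 mu2]; have [[lv vu] _] := uv_sol.
rewrite /lagrangian geeDl// lee_fin -[(Al u - v)%R]opprB -[(v - Au u)%R]opprB.
rewrite !linearN -opprD oppr_le0 addr_ge0//.
  by apply: mu1; rewrite vsubr_ge0.
by apply: mu2; rewrite vsubr_ge0.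
Qed.

Lemma primal_value_fin : primal_objective a h J u v \is a fin_num.
Proof. by rewrite /primal_objective fin_numD Ju fin_numM. Qed.

Lemma saddle_dual_solution mu : pair_ge0 mu -> saddle mu ->
  dual_solution a h J Al Au mu.
Proof.
move=> mu0 sad; split => // nu nu0.
apply: (le_trans (dual_objective_le_lagrangian nu u v)).
apply: (le_trans (lagrangian_le_primal nu0)).
rewrite -(fineK primal_value_fin); apply: (le_dual_objective Ju hv) => u' v'.
by rewrite (fineK primal_value_fin); exact: sad.
Qed.

(** The constraint is that [(Al u - v, v - Au u)] be nonpositive in [Y * Y], and
the multiplier in the dual of [Y * Y] is split into its two components. *)
Lemma slater_saddle (u0 : X) (v0 : Y) (rho : R) :
  econvex h -> econvex J -> J u0 < +oo -> h v0 < +oo -> (0 < rho)%R ->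
  (forall z, (`|z| <= rho)%R -> (Al u0 - z ⪯ v0)%R /\ (v0 ⪯ Au u0 + z)%R) ->
  exists2 mu, pair_ge0 mu & saddle mu.
Proof.
move=> hcvx Jcvx Ju0 hv0 rho0 slater.
pose K : set (Y * Y) := [set z | 0 ⪯ z.1 /\ 0 ⪯ z.2]%R.
pose F (w : X * Y) := primal_objective a h J w.1 w.2.
pose G (w : X * Y) : Y * Y := (Al w.1 - w.2, w.2 - Au w.1)%R.
have linG : linear G.
  move=> t [x y] [x' y']; rewrite /G /=; congr pair; rewrite linearP/=.
    by rewrite opprD addrACA scalerBr.
  by rewrite opprD addrACA scalerBr.
pose GP : {linear (X * Y)%type -> (Y * Y)%type} :=
  HB.pack G (GRing.isLinear.Build _ _ _ _ _ linG).
have Fcvx : econvex F.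
  move=> t [x y] [x' y'] t01; rewrite /F /primal_objective /=.
  have t0 : 0 <= t%:E by case/andP: t01.
  have t1 : 0 <= (1 - t)%:E by case/andP: t01 => _; rewrite lee_fin subr_ge0.
  have a0 : 0 <= (a^-1)%:E by rewrite lee_fin invr_ge0 ltW.
  rewrite !ge0_muleDr// ?mule_ge0// addeACA; apply: leeD; last exact: Jcvx.
  apply: (le_trans (lee_wpmul2l a0 (hcvx t y y' t01))).
  by rewrite ge0_muleDr ?mule_ge0// !muleA ![(a^-1)%:E * _]muleC.
have [||||||||l [l0 lP]] := @lagrange_multiplier R (X * Y)%type (Y * Y)%type K F GP
    (fine (primal_objective a h J u v)) rho (u0, v0).
- by split; exact: vle_refl.
- by move=> z z' [z1 z2] [z1' z2']; split; exact: vle0D.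
- by move=> t z t0 [z1 z2]; split; apply: vle0Z => //; exact: ltW.
- exact: Fcvx.
- move=> [x y] [/= Kx Ky]; rewrite (fineK primal_value_fin).
  by apply: uv_sol.2; split; rewrite -vsubr_ge0 -opprB.
- exact: rho0.
- rewrite /F /primal_objective /= lte_add_pinfty// lte_mul_pinfty// lee_fin.
  by rewrite invr_ge0 ltW.
- move=> [z1 z2]; rewrite prod_normE/= ge_max => /andP[z1r z2r].
  have [z1v _] := slater _ z1r; have [_ z2v] := slater _ z2r.
  split; rewrite /GP /G /=.
    by rewrite opprB addrCA -[(z1 - _)%R]opprB vsubr_ge0.
  by rewrite opprB addrA [(z2 + _)%R]addrC vsubr_ge0.
pose mu : Y^dual * Y^dual :=
  (bcomp l (bpair (@bid R Y) 0%R), bcomp l (bpair 0%R (@bid R Y))).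
have muE z1 z2 : (l (z1, z2) = mu.1 z1 + mu.2 z2)%R.
  transitivity (l ((z1, 0) + (0, z2)))%R; last by rewrite linearD.
  by congr (l (_, _)); rewrite ?addr0 ?add0r.
exists mu.
  by split=> z z0; apply: l0; split => //; exact: vle_refl.
move=> x y; rewrite -(fineK primal_value_fin) /lagrangian -muE.
exact: (lP (x, y)).
Qed.

Section Optimality.
Variable mu : Y^dual * Y^dual.
Hypotheses (mu_ge0 : pair_ge0 mu) (mu_saddle : saddle mu).

Lemma complementary_slackness :
  (mu.1 (Al u) = mu.1 v)%R /\ (mu.2 (Au u) = mu.2 v)%R.
Proof.
have [mu1 mu2] := mu_ge0; have [[lv vu] _] := uv_sol.
have le1 : (mu.1 (Al u) <= mu.1 v)%R.
  by rewrite -subr_ge0 -linearB; apply: mu1; rewrite vsubr_ge0.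
have le2 : (mu.2 v <= mu.2 (Au u))%R.
  by rewrite -subr_ge0 -linearB; apply: mu2; rewrite vsubr_ge0.
have := mu_saddle u v; rewrite /lagrangian -(fineK primal_value_fin) -EFinD lee_fin.
rewrite lerDl !linearB/= => sum0; split; lra.
Qed.

(** [u] minimizes the Lagrangian in its first variable. *)
Lemma saddle_subdiff : subdiff J u (- adjoint (Bop Al Au) mu)%R.
Proof.
have [e1 e2] := complementary_slackness.
split => // u'; have := mu_saddle u' v.
rewrite /lagrangian /primal_objective adjoint_BopE !linearB/=.
have [->|Ju'] := eqVneq (J u') +oo; first by rewrite leey.
have /fineK <- : J u' \is a fin_num by rewrite ge0_fin_numE// ltey.
rewrite -(fineK Ju) -(fineK hv) -!EFinM -!EFinD !lee_fin; lra.
Qed.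

(** [a E^T mu] is a subgradient of [h] at [v]. *)
Lemma saddle_data_subgradient v' : h v' \is a fin_num ->
  ((mu.1 v' - mu.1 v) - (mu.2 v' - mu.2 v) <= a^-1 * (fine (h v') - fine (h v)))%R.
Proof.
have [e1 e2] := complementary_slackness.
move=> hv'; have := mu_saddle u v'.
rewrite /lagrangian /primal_objective !linearB/=.
rewrite -(fineK Ju) -(fineK hv) -(fineK hv') -!EFinM -!EFinD !lee_fin; lra.
Qed.

(** By complementary slackness the multipliers see [v] in place of [Al u] and
[Au u], and they only lose when [Al u'] and [Au u'] are replaced by [v']. *)
Lemma saddle_subgradient_le u' v' : feasible Al Au u' v' -> h v' \is a fin_num ->
  ((- adjoint (Bop Al Au) mu) (u - u') <= a^-1 * (fine (h v') - fine (h v)))%R.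
Proof.
move=> [lv' v'u] /saddle_data_subgradient; apply: le_trans.
have [mu1 mu2] := mu_ge0; have [e1 e2] := complementary_slackness.
have le1 : (0 <= mu.1 (v' - Al u'))%R by apply: mu1; rewrite vsubr_ge0.
have le2 : (0 <= mu.2 (Au u' - v'))%R by apply: mu2; rewrite vsubr_ge0.
by move: le1 le2; rewrite adjoint_BopE !linearB/= e1 e2; lra.
Qed.

End Optimality.

(** A dual solution [mu] has at least the dual value of [nu], which is the primal
value, and the Lagrangian of [mu] lies above the dual value of [mu]. *)
Lemma dual_solution_saddle nu mu : pair_ge0 nu -> saddle nu ->
  dual_solution a h J Al Au mu -> saddle mu.
Proof.
move=> nu0 nu_sad [mu0 mu_max] u' v'.
apply: le_trans (dual_objective_le_lagrangian mu u' v').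
apply: le_trans (mu_max nu nu0).
rewrite -(fineK primal_value_fin); apply: (le_dual_objective Ju hv) => x y.
by rewrite (fineK primal_value_fin); exact: nu_sad.
Qed.

End Duality.

(** * Order and norm of signed measures *)

Lemma smeas_norm_le {d : measure_display} {T : measurableType d} {R : realType}
  (m n : smeas T R) : 0 ⪯ m -> m ⪯ n -> `|m| <= `|n|.
Proof.
move=> m0 mn; have [P [N [mP mN PNT PN0 mE]]] := tv_norm_hahn m.
rewrite -[`|m|]/(tv_norm m) mE.
apply: le_trans (tv_norm_split n mP mN PNT PN0).
have N0 : 0 <= m N := m0 _ mN.
have nN : m N <= n N := mn _ mN.
have P0 : m P <= n P := mn _ mP.
by rewrite (le_trans _ (lerD (ler_norm _) (normr_ge0 _)))// addr0 lerBlDr ler_wpDr.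
Qed.

(** The bounds [Al <= A <= Au] only concern the positive cone, whereas [u] is
arbitrary; splitting [u] into two positive parts of comparable norm makes them
control [A - Al] in operator norm. *)
Lemma bracket_error {d : measure_display} {T : measurableType d} {R : realType}
    {U : banachLatticeType R} (Al A Au : blin (U^dual) (smeas T R))
    (u : U^dual) (v : smeas T R) :
  op_le Al A -> op_le A Au -> Al u ⪯ v -> v ⪯ Au u ->
  `|A u - v| <= 4 * `|Au - Al| * `|u|.
Proof.
move=> AlA AAu lv vu; pose e := `|Au - Al|.
have eP (w : U^dual) : `|Au w - Al w| <= e * `|w| := opnormP (Au - Al) w.
have e0 : 0 <= e := normr_ge0 _.
have pos (w : U^dual) : dual_ge0 w -> `|A w - Al w| <= e * `|w|.
  move=> w0; apply: le_trans (eP w); apply: smeas_norm_le.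
    by rewrite vsubr_ge0; exact: AlA.
  by apply: vle_add2r; exact: AAu.
have [w [w0 wu0 wu]] := dual_pos_majorant u.
have -> : A u - v = (A - Al) w - (A - Al) (w - u) - (v - Al u).
  have -> : (A - Al) (w - u) = (A - Al) w - (A u - Al u).
    exact: (linearB (A - Al) w u).
  by rewrite subKr opprB addrA subrK.
have wuu : `|w - u| <= 2 * `|u|.
  by rewrite (le_trans (ler_normB _ _))// mulr_natl mulr2n lerD2r.
have vAl : `|v - Al u| <= e * `|u|.
  apply: le_trans (eP u); apply: smeas_norm_le; first by rewrite vsubr_ge0.
  exact: vle_add2r.
rewrite (le_trans (ler_normB _ _))// (le_trans (lerD (ler_normB _ _) vAl))//.
rewrite (le_trans (lerD (lerD (pos w w0) (pos _ wu0)) (lexx _)))//.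
rewrite (_ : 4 * e * `|u| = e * `|u| + e * (2 * `|u|) + e * `|u|); last by ring.
by rewrite lerD2r lerD// ler_wpM2l.
Qed.

(** * The Fenchel-Young inequality for the divergence *)

(** The upper function may fail to be measurable; for the integrand of a
divergence, measurability would need an argument of its own. *)
Lemma ge0_integral_le {d : measure_display} {T : measurableType d} {R : realType}
    (mu : {measure set T -> \bar R}) (f g : T -> \bar R) :
  (forall x, 0 <= f x)%E -> (forall x, f x <= g x)%E ->
  (\int[mu]_x f x <= \int[mu]_x g x)%E.
Proof.
move=> f0 fg; rewrite !ge0_integralTE//; last first.
  by move=> x; exact: le_trans (fg x).
apply: le_ereal_sup => _ [h hf <-]; exists h => // x /=.
exact: le_trans (hf x) (fg x).
Qed.

Lemma bounded_measurable_integrable {d : measure_display} {T : measurableType d}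
    {R : realType} (mu : {finite_measure set T -> \bar R}) (g : T -> R) (M : R) :
  measurable_fun setT g -> (forall x, `|g x| <= M) ->
  mu.-integrable setT (EFin \o g).
Proof.
move=> mg gM; apply: measurable_bounded_integrable => //.
  by rewrite ltey_eq fin_num_measure.
exists M; split; [exact: num_real|move=> N MN x _].
by rewrite /= (le_trans (gM x))// ltW.
Qed.

Lemma pos_neg_part_ge0 {d : measure_display} {T : measurableType d} {R : realType}
    (m : smeas T R) : 0 ⪯ m -> forall E, measurable E ->
  pos_part m E = (m E)%:E /\ neg_part m E = 0%E.
Proof.
move=> m0 E mE; rewrite /pos_part /neg_part.
case: (smeas_hahn m) => -[P N] /= PN.
have [_ [mN negN] _ _] := PN.
have negE : jordan_neg PN E = 0%E.
  rewrite jordan_negE cjordan_negE /crestr0 mem_set// /crestr.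
  have mEN : measurable (E `&` N) by exact: measurableI.
  have -> : charge_of_smeas m (E `&` N) = 0%E.
    have mneg := negN _ mEN (@subIsetr _ _ _).
    by apply/eqP; rewrite eq_le mneg /= lee_fin; exact: m0.
  by rewrite oppe0.
split => //; transitivity (charge_of_smeas m E) => //.
have -> : charge_of_smeas m E = (jordan_pos PN E + (-1)%:E * jordan_neg PN E)%E.
  by rewrite (jordan_decomp PN mE).
by rewrite negE mule0 adde0.
Qed.

Section Young.
Context {d : measure_display} {T : measurableType d} {R : realType}.
Implicit Types (p q : prob T R) (z : T -> R).

Lemma smeas_int_prob p z : smeas_int p z = Rintegral (prob_measure p) setT z.
Proof.
have /asboolP[p0 _] := prob_valP p.
rewrite /smeas_int /Rintegral.
rewrite (eq_measure_integral (prob_measure p) (m1 := pos_part p)); last first.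
  by move=> E mE _; have [pE _] := pos_neg_part_ge0 p0 mE; exact: pE.
rewrite (eq_measure_integral mzero (m1 := neg_part p)); last first.
  by move=> E mE _; have [_ pE] := pos_neg_part_ge0 p0 mE; exact: pE.
by rewrite integral_measure_zero subr0.
Qed.

Variable phi : R -> R.
Hypothesis phi_ge0 : forall y : R, 0 < y -> 0 <= phi y.

Lemma phi0_ge0 y : (0 <= phi0 phi y)%E.
Proof.
rewrite /phi0; case: ifPn => [y0|_]; first by rewrite lee_fin phi_ge0.
(* without a limit at 0, [lim] takes its default value 0 *)
have [cvgphi|/dvgP -> //] := pselect (cvg ((phi t)%:E @[t --> 0^'+])).
apply: lime_ge => //; near=> t; rewrite lee_fin phi_ge0//.
Unshelve. all: by end_near. Qed.

(** For [0 <= z <= X] the line of slope [z] through [(1, 0)] lies below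
[phi + rho] as soon as the one of slope [X] does: right of 1 it is lower, and
left of 1 it is nonpositive. *)
Lemma phi0_ge_line (X rho z y : R) : 0 <= rho ->
  (forall t, 0 < t -> X * t - phi t <= X + rho) -> 0 <= z <= X ->
  ((z * (y - 1) - rho)%:E <= phi0 phi y)%E.
Proof.
move=> rho0 Xrho /andP[z0 zX]; have [y1|y1] := leP y 1.
  apply: le_trans (phi0_ge0 y); rewrite lee_fin subr_le0.
  by rewrite (le_trans _ rho0)// mulr_ge0_le0// subr_le0.
have y0 : 0 < y by rewrite (lt_trans _ y1).
rewrite /phi0 y0 lee_fin; have := Xrho y y0.
have : z * (y - 1) <= X * (y - 1) by rewrite ler_wpM2r// subr_ge0 ltW.
by lra.
Qed.

Local Open Scope charge_scope.

Lemma prob_density_change_of_variables p q z :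
  (prob_measure p).-integrable setT (EFin \o z) ->
  charge_of_smeas p `<< prob_measure q ->
  (\int[prob_measure q]_x
     ((z x)%:E * ('d (charge_of_smeas p) '/d (prob_measure q)) x)
   = \int[prob_measure p]_x (z x)%:E)%E.
Proof.
move=> iz pq; have pq' : prob_measure p `<< prob_measure q by [].
rewrite -(Radon_Nikodym_change_of_variables pq' measurableT iz).
have mEz := measurable_int _ iz.
have iRN (nu : {charge set T -> \bar R}) : nu `<< prob_measure q ->
    (prob_measure q).-integrable setT ('d nu '/d (prob_measure q)).
  exact: Radon_Nikodym_integrable.
have mRN (nu : {charge set T -> \bar R}) (nuq : nu `<< prob_measure q) := measurable_int _ (iRN nu nuq).
apply: ae_eq_integral => //.
- by apply: emeasurable_funM => //; exact: mRN.
- by apply: emeasurable_funM => //; exact: mRN.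
apply: ae_eqe_mul2l; apply: integral_ae_eq => //.
  exact: iRN.
by move=> E _ mE; rewrite -!Radon_Nikodym_integral.
Qed.

(** The bound by a line of slope [z x] holds pointwise at the density [y x] of [v],
and [z * y] integrates to the integral of [z] against [v]. *)
Lemma divergence_young (v : smeas T R) q z (X rho H : R) :
  measurable_fun setT z -> (forall x, 0 <= z x <= X) -> 0 <= rho ->
  (forall t, 0 < t -> X * t - phi t <= X + rho) ->
  (Hphi phi v q <= H%:E)%E ->
  smeas_int v z <= smeas_int q z + H + rho.
Proof.
move=> mz zX rho0 Xrho; rewrite /Hphi; case: ifPn; last by rewrite leye_eq.
move=> /asboolP[vprob vq] Hle.
pose p : prob T R := Prob (asboolT vprob).
have zM x : `|z x| <= X by case/andP: (zX x) => z0 ?; rewrite ger0_norm.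
have iz (m : prob T R) : (prob_measure m).-integrable setT (EFin \o z).
  exact: (bounded_measurable_integrable _ mz zM).
pose y := fine \o 'd (charge_of_smeas p) '/d (prob_measure q).
have yE x : (y x)%:E = ('d (charge_of_smeas p) '/d (prob_measure q)) x.
  by rewrite /y /= fineK// Radon_Nikodym_fin_num.
have izy : (prob_measure q).-integrable setT (fun x => (z x * y x)%:E).
  apply: (eq_integrable measurableT ((EFin \o z) \*
    'd (charge_of_smeas p) '/d (prob_measure q))%E).
    by move=> x _; rewrite /= EFinM yE.
  apply: integrableMr => //; last exact: Radon_Nikodym_integrable.
  exists X; split; [exact: num_real|move=> N XN x _].
  by rewrite /= (le_trans (zM x))// ltW.
pose t x := z x * y x - (z x + rho).
have izr : (prob_measure q).-integrable setT (fun x => (z x + rho)%:E).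
  apply: (@bounded_measurable_integrable _ _ _ _ _ (X + rho)).
    exact: measurable_funD.
  by move=> x; rewrite (le_trans (ler_normD _ _))// lerD// ger0_norm.
have tH : (\int[prob_measure q]_x (t x)%:E <= H%:E)%E.
  apply: le_trans Hle; rewrite integralE.
  apply: (@le_trans _ _ (\int[prob_measure q]_x (EFin \o t)^\+ x)%E).
    by rewrite geeDl// oppe_le0 integral_ge0.
  apply: ge0_integral_le => // x; rewrite funeposE ge_max.
  apply/andP; split; last exact: phi0_ge0.
  have := phi0_ge_line (y x) rho0 Xrho (zX x); apply: le_trans.
  by rewrite lee_fin /t; lra.
move: tH; rewrite /t; under eq_integral => x _ do rewrite EFinB.
rewrite integralB//.
have -> : (\int[prob_measure q]_x (z x * y x)%:E = (smeas_int v z)%:E)%E.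
  rewrite (smeas_int_prob p) /Rintegral fineK; last exact: integrable_fin_num (iz p).
  rewrite -(prob_density_change_of_variables (iz p) vq).
  by apply: eq_integral => x _; rewrite EFinM yE.
have -> : (\int[prob_measure q]_x (z x + rho)%:E = (smeas_int q z + rho)%:E)%E.
  rewrite smeas_int_prob; under eq_integral => x _ do rewrite EFinD.
  have irho := finite_measure_integrable_cst (prob_measure q) rho measurableT.
  rewrite (integralD measurableT (iz q) irho).
  have -> : (\int[prob_measure q]_x (EFin \o cst rho) x = rho%:E)%E.
    transitivity (rho%:E * prob_measure q setT)%E.
      exact: (integral_cst (prob_measure q) measurableT rho%:E).
    by rewrite prob_measureT mule1.
  by rewrite EFinD /Rintegral fineK//; exact: integrable_fin_num (iz q).
by rewrite -EFinB lee_fin; lra.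
Qed.

End Young.

(** * The oscillation of an integral between two measures of small divergence *)

Lemma smeas_int_prob_affine {d : measure_display} {T : measurableType d}
    {R : realType} (p : prob T R) (g : T -> R) (M a b : R) :
  measurable_fun setT g -> (forall x, `|g x| <= M) ->
  smeas_int p (fun x => a * g x + b) = a * smeas_int p g + b.
Proof.
move=> mg gM; rewrite !smeas_int_prob.
have ig := bounded_measurable_integrable (prob_measure p) mg gM.
have ib := finite_measure_integrable_cst (prob_measure p) b measurableT.
rewrite RintegralD//; last exact: (integrableZl measurableT a ig).
rewrite RintegralZl// Rintegral_cst//.
congr (_ + _); transitivity (b * fine (prob_measure p setT)) => //.
by rewrite prob_measureT mulr1.
Qed.

(** Both [g] and [- g] are shifted to nonnegative functions, because nothing
relates the two sides of [r] at 0. *)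
Lemma divergence_oscillation {d : measure_display} {T : measurableType d}
    {R : realType} (phi : R -> R) (phi_ge0 : forall y : R, 0 < y -> 0 <= phi y)
    (p pbar q : prob T R) (g : T -> R) (t0 : T) (K a rho H Hbar : R) :
  measurable_fun setT g -> (forall x y, g x - g y <= K) -> 0 < a -> 0 <= rho ->
  (forall y : R, 0 < y -> K * a * y - phi y <= K * a + rho) ->
  (Hphi phi p q <= H%:E)%E -> (Hphi phi pbar q <= Hbar%:E)%E ->
  smeas_int p g - smeas_int pbar g <= (H + Hbar + 2 * rho) / a.
Proof.
move=> mg gK a0 rho0 Xrho pH pbarH.
have gM x : `|g x| <= `|g t0| + K.
  rewrite -lerBlDl (le_trans (lerB_dist _ _))// ler_norml gK andbT.
  by rewrite lerNl opprB gK.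
pose m := inf (range g).
have m_le x : m <= g x.
  apply: ge_inf; last by exists x.
  by exists (g t0 - K) => _ [y _ <-]; rewrite lerBlDr addrC -lerBlDr.
have g_le x : g x <= m + K.
  rewrite -lerBlDr; apply: lb_le_inf; first by exists (g t0), t0.
  by move=> _ [y _ <-]; rewrite lerBlDr addrC -lerBlDr.
have young (s : prob T R) Hs (z : T -> R) : (Hphi phi s q <= Hs%:E)%E ->
    measurable_fun setT z -> (forall x, 0 <= z x <= K * a) ->
    smeas_int s z <= smeas_int q z + Hs + rho.
  by move=> sH mz zK; exact: (divergence_young phi_ge0 mz zK rho0 Xrho sH).
have aff b c (s : prob T R) := smeas_int_prob_affine s b c mg gM.
have maff b c : measurable_fun setT (fun x => b * g x + c).
  by apply: measurable_funD => //; exact: measurable_funM.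
have up : smeas_int p g - smeas_int q g <= (H + rho) / a.
  have := young _ _ _ pH (maff a (- (a * m))).
  rewrite !aff ler_pdivlMr// => up; have {}up := up _.
  suff : a * smeas_int p g - a * m <= a * smeas_int q g - a * m + H + rho by lra.
  apply: up => x; rewrite -mulrBr mulr_ge0 ?subr_ge0 ?(ltW a0)//=.
  by rewrite mulrC ler_pM2r// lerBlDl.
have down : smeas_int q g - smeas_int pbar g <= (Hbar + rho) / a.
  have := young _ _ _ pbarH (maff (- a) (a * (m + K))).
  rewrite !aff ler_pdivlMr// => down; have {}down := down _.
  suff : - a * smeas_int pbar g + a * (m + K) <=
    - a * smeas_int q g + a * (m + K) + Hbar + rho by lra.
  apply: down => x; rewrite mulNr addrC -mulrBr mulr_ge0 ?subr_ge0 ?(ltW a0)//=.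
  by rewrite mulrC ler_pM2r//; have := m_le x; lra.
rewrite [leLHS](_ : _ = (smeas_int p g - smeas_int q g) +
  (smeas_int q g - smeas_int pbar g)); last by ring.
apply: (le_trans (lerD up down)); rewrite -mulrDl ler_pM2r ?invr_gt0//; lra.
Qed.

(** * The remainder of the conjugate *)

Lemma doubling_iter {R : realType} (r : R -> \bar R) (c e : R) : 1 <= c ->
  (forall x : R, 0 < x -> x < e -> (r (2 * x)%R <= c%:E * r x)%E) ->
  forall m (x : R), 0 < x -> 2 ^+ m * x < e ->
    (r (2 ^+ m * x)%R <= (c ^+ m)%:E * r x)%E.
Proof.
move=> c1 dbl; have c0 : 0 <= c by rewrite (le_trans ler01).
elim=> [|m IHm] x x0 xe; first by rewrite !expr0 mul1r mul1e.
have mx0 : 0 < 2 ^+ m * x by rewrite mulr_gt0// exprn_gt0.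
have mxe : 2 ^+ m * x < e.
  by apply: le_lt_trans xe; rewrite exprS -mulrA ler_peMl ?(ltW mx0)// ler1n.
rewrite exprS -mulrA (le_trans (dbl _ mx0 mxe))// exprS EFinM -muleA.
by rewrite lee_wpmul2l ?lee_fin//; exact: IHm.
Qed.

Section Remainder.
Context {R : realType} (phi : R -> R) (r : R -> \bar R).
Hypotheses (phi1 : phi 1 = 0) (phi_ge0 : forall y : R, 0 < y -> 0 <= phi y).
Hypothesis phi_conjE : forall x, phi_conj phi x = (x%:E + r x)%E.

(** [r x] is the supremum over [y > 0] of the expression on the left. *)
Lemma remainder_ge (x y : R) : 0 < y -> ((x * (y - 1) - phi y)%:E <= r x)%E.
Proof.
move=> y0; have : ((x * y - phi y)%:E <= x%:E + r x)%E.
  by rewrite -phi_conjE; apply: ereal_sup_ubound; exists y.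
case: (r x) => [s| |]; [|by move=> _; exact: leey|by rewrite addeNy leeNy_eq].
by rewrite -EFinD !lee_fin; lra.
Qed.

Lemma remainder_ge0 (x : R) : (0 <= r x)%E.
Proof. by have := @remainder_ge x 1 ltr01; rewrite subrr mulr0 phi1 subr0. Qed.

Lemma remainder_le (x : R) (s : R) :
  (forall y, 0 < y -> x * (y - 1) - phi y <= s) -> (r x <= s%:E)%E.
Proof.
move=> xs; have : (x%:E + r x <= x%:E + s%:E)%E.
  rewrite -phi_conjE; apply: ge_ereal_sup => _ [y /= y0 <-].
  by rewrite -EFinD lee_fin; have := xs y y0; lra.
by rewrite leeD2lE.
Qed.

(** For [x >= 0] the points [y < 1] contribute nothing above 0 to the supremum
that defines [r x], and those with [y >= 1] contribute increasingly in [x]. *)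
Lemma remainder_homo (x x' : R) : 0 <= x -> x <= x' -> (r x <= r x')%E.
Proof.
move=> x0 xx'; have := @remainder_ge x'; have := remainder_ge0 x'.
case: (r x') => [s| |]; [|by move=> _ _; exact: leey|by rewrite leeNy_eq].
rewrite lee_fin => s0 x's; apply: remainder_le => y y0.
have [y1|y1] := leP y 1.
  rewrite (le_trans _ s0)// subr_le0 (le_trans _ (phi_ge0 y0))//.
  by rewrite mulr_ge0_le0// subr_le0.
have := x's y y0; rewrite lee_fin.
have : x * (y - 1) <= x' * (y - 1) by rewrite ler_wpM2r// subr_ge0 ltW.
by lra.
Qed.

End Remainder.

(** * From the excess to the rate *)

(** For a doubling [r], a factor [K <= 2 ^ m] inside of [r] costs a factor
[c ^ m] outside. *)
Lemma rate_bound_of_bigO {R : realType} {T : Type} (g : T -> R) (r : R -> \bar R)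
    (delta alpha eta : nat -> R) (a : nat -> \bar R) (K : R) :
  (forall x, 0 <= r x)%E ->
  (forall x x' : R, 0 <= x -> x <= x' -> (r x <= r x')%E) ->
  (forall n, 0 <= delta n) -> (forall n, 0 < alpha n) -> (forall n, 0 <= eta n) ->
  alpha @ \oo --> 0 -> 0 <= K -> (forall x y, g x - g y <= K) ->
  (forall K : R, (forall x y, g x - g y <= K) ->
    ereal_bigO a (rate r delta alpha eta K)) ->
  rate_bound g r delta alpha eta a.
Proof.
move=> r0 rhomo d0 al0 eta0 al_cvg K0 gK aO; split => // -[c c_dbl].
have [C C0 aC] := aO K gK.
(* with [c1 >= 1], a factor [c1 ^ m] only increases the terms without [r] *)
pose c1 := maxr c 1.
have c1_ge1 : 1 <= c1 by rewrite le_max lexx orbT.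
have [e e0 c1_dbl] : exists2 e : R, 0 < e &
    forall x : R, 0 < x -> x < e -> (r (2 * x)%R <= c1%:E * r x)%E.
  have [e /= e0 eP] := c_dbl; exists e => // x x0 xe.
  apply: (@le_trans _ _ (c%:E * r x)%E).
    by apply: eP => //; rewrite /= sub0r normrN gtr0_norm.
  by rewrite lee_wpmul2r// lee_fin le_max lexx.
pose m := (truncn K).+1.
have K2m : K <= 2 ^+ m.
  rewrite (le_trans (ltW (truncnS_gt K)))// -natrX ler_nat.
  exact/ltnW/ltn_expl.
have cm0 : 0 < c1 ^+ m by rewrite exprn_gt0// (lt_le_trans _ c1_ge1).
exists (C * c1 ^+ m); first exact: mulr_gt0.
have small : \forall n \near \oo, 2 ^+ m * alpha n < e.
  have e2 : 0 < e / 2 ^+ m by rewrite divr_gt0// exprn_gt0.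
  have : \forall n \near \oo, `|0 - alpha n| < e / 2 ^+ m.
    by have /cvgrPdist_lt := al_cvg; exact.
  apply: filterS => n; rewrite sub0r normrN gtr0_norm//.
  by rewrite ltr_pdivlMr ?exprn_gt0// mulrC.
near=> n.
have an : (`|a n| <= C%:E * rate r delta alpha eta K n)%E by near: n.
have sn : 2 ^+ m * alpha n < e by near: n.
apply: (le_trans an); rewrite EFinM -muleA lee_pmul2l ?lte_fin//.
have ai0 : (0 <= ((alpha n)^-1)%:E)%E by rewrite lee_fin invr_ge0 ltW.
have cm1 : 1 <= c1 ^+ m by rewrite exprn_ege1.
have grow (x : R) : 0 <= x -> (x%:E <= (c1 ^+ m)%:E * x%:E)%E.
  by move=> x0; rewrite -EFinM lee_fin ler_peMl.
have dn0 : 0 <= delta n / alpha n by rewrite divr_ge0// ltW.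
have rn0 : (0 <= r (1 * alpha n)%R * ((alpha n)^-1)%:E)%E by rewrite mule_ge0.
rewrite /rate ge0_muleDr ?adde_ge0 ?lee_fin// ge0_muleDr ?lee_fin//.
apply: leeD; last exact: grow.
apply: leeD; first exact: grow.
rewrite muleA lee_wpmul2r// mul1r.
apply: (@le_trans _ _ (r (2 ^+ m * alpha n)%R)).
  by apply: rhomo; rewrite ?mulr_ge0 ?(ltW (al0 n))// ler_wpM2r// ltW.
exact: (doubling_iter _ c1_dbl).
Unshelve. all: by end_near. Qed.

(** The excess splits into the error of the bracket, the oscillation of [g]
between [v n] and [fbar] (measured through [f n]) and the noise level. The
fidelity [H n] cancels. The norms of the [u n] may grow like [delta / alpha];
this growth costs only a multiple of [delta / alpha], since [eta] vanishes. *)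
Lemma excess_bigO {d : measure_display} {T : measurableType d} {R : realType}
    {U : banachLatticeType R} (phi : R -> R) (r : R -> \bar R)
    (Al Au : nat -> blin (U^dual) (smeas T R)) (A : blin (U^dual) (smeas T R))
    (fbar : prob T R) (f : nat -> prob T R) (alpha delta eta : nat -> R)
    (g : T -> R) (G : (smeas T R)^dual) (t0 : T) (M : R)
    (u : nat -> U^dual) (v : nat -> smeas T R) (H : nat -> R) (a : nat -> \bar R) :
  phi 1 = 0 -> (forall y : R, 0 < y -> 0 <= phi y) ->
  (forall x, phi_conj phi x = (x%:E + r x)%E) ->
  (forall n, op_le (Al n) A) -> (forall n, op_le A (Au n)) ->
  (forall n, `|Au n - Al n| <= eta n) -> eta @ \oo --> 0 ->
  (forall n, 0 < alpha n) -> (forall n, 0 <= delta n) ->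
  (forall n, (Hphi phi fbar (f n) <= (delta n)%:E)%E) ->
  measurable_fun setT g -> (forall w, G w = smeas_int w g) ->
  (forall n, `|u n| <= M * (1 + delta n / alpha n)) ->
  (forall n, Al n (u n) ⪯ v n /\ v n ⪯ Au n (u n)) ->
  (forall n, Hphi phi (v n) (f n) = (H n)%:E) ->
  (forall n, (0 <= a n)%E /\
    (a n <= ((delta n - H n) / alpha n + (G (A (u n)) - G fbar))%:E)%E) ->
  forall K : R, (forall x y, g x - g y <= K) ->
    ereal_bigO a (rate r delta alpha eta K).
Proof.
move=> phi1 phi_ge0 conjE AlA AAu eta_b eta_cvg al0 d0 dH mg GE uM uv vH aP K gK.
have K0 : 0 <= K by rewrite (le_trans _ (gK t0 t0))// subrr.
have M0 : 0 <= M.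
  have M1 := le_trans (normr_ge0 _) (uM 0%N).
  by move: M1; rewrite pmulr_lge0// ltr_wpDr// divr_ge0// ltW.
pose L := opnorm G; have L0 : 0 <= L := opnorm_ge0 G.
pose C := 2 + 4 * L * M.
have LM0 : 0 <= 4 * L * M by rewrite !mulr_ge0.
have C0 : 0 < C by rewrite ltr_pwDl.
exists C => //.
have eta1 : \forall n \near \oo, eta n <= 1.
  have : \forall n \near \oo, `|0 - eta n| < 1 by have /cvgrPdist_lt := eta_cvg; exact.
  by apply: filterS => n; rewrite sub0r normrN => /ltW; apply: le_trans; exact: ler_norm.
near=> n.
have en1 : eta n <= 1 by near: n.
have en0 : 0 <= eta n := le_trans (normr_ge0 _) (eta_b n).
have [an0 anE] := aP n; rewrite gee0_abs//; apply: (le_trans anE).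
have Kr := remainder_ge0 phi1 conjE (K * alpha n).
rewrite /rate; case rE : (r (K * alpha n)) Kr => [rho| |]; last by rewrite leeNy_eq.
  rewrite lee_fin => rho0.
  rewrite [leRHS](_ : _ = (C * (delta n / alpha n + rho * (alpha n)^-1 + eta n))%:E)//.
  rewrite lee_fin.
  have vprob : is_prob (v n).
    by have := vH n; rewrite /Hphi; case: ifPn => // /asboolP[].
  have Xrho (y : R) : 0 < y -> K * alpha n * y - phi y <= K * alpha n + rho.
    move=> y0; have := remainder_ge conjE (K * alpha n) y0.
    by rewrite rE lee_fin; lra.
  have vHle : (Hphi phi (Prob (asboolT vprob)) (f n) <= (H n)%:E)%E by rewrite /= vH.
  have osc := divergence_oscillation phi_ge0 t0 mg gK (al0 n) rho0 Xrho vHle (dH n).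
  have [lv vu] := uv n.
  have br := bracket_error (AlA n) (AAu n) lv vu.
  have GAv : G (A (u n) - v n) <= L * (4 * eta n * (M * (1 + delta n / alpha n))).
    rewrite (le_trans (ler_norm _))// (le_trans (opnormP _ _))// ler_wpM2l//.
    rewrite (le_trans br)// ler_pM// ?mulr_ge0//.
    by rewrite ler_wpM2l.
  move: osc; rewrite /= -!GE => osc.
  set D := delta n / alpha n in GAv *.
  have D0 : 0 <= D by rewrite divr_ge0// ltW.
  set B := rho * (alpha n)^-1; have B0 : 0 <= B by rewrite mulr_ge0// invr_ge0 ltW.
  have GAvE : G (A (u n) - v n) = G (A (u n)) - G (v n) by rewrite linearB.
  have e1 : (delta n - H n) / alpha n + (H n + delta n + 2 * rho) / alpha n
      = 2 * D + 2 * B by rewrite /D /B; ring.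
  have eD : eta n * D <= D by rewrite ler_piMl.
  have LMeD : 4 * L * M * (eta n * D) <= 4 * L * M * D by rewrite ler_wpM2l.
  have LMB : 0 <= 4 * L * M * B by rewrite mulr_ge0.
  have e2 : L * (4 * eta n * (M * (1 + D)))
      = 4 * L * M * eta n + 4 * L * M * (eta n * D) by ring.
  have e3 : C * (D + B + eta n) = 2 * D + 2 * B + 2 * eta n +
    4 * L * M * D + 4 * L * M * B + 4 * L * M * eta n by rewrite /C; ring.
  rewrite e3; move: osc GAv; rewrite e2 GAvE; lra.
(* where [r] is infinite so is the rate *)
move=> _; rewrite gt0_mulye ?lte_fin ?invr_gt0// addey// addye//.
by rewrite gt0_muley ?lte_fin// leey.
Unshelve. all: by end_near. Qed.

Lemma continuous_borel_measurable {R : realType} (Omega : PointedMetric.type R)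
  (g : continuousType Omega R) : measurable_fun [set: borel Omega] (g : borel Omega -> R).
Proof.
have /continuousP cg := @cts_fun _ _ g.
apply: (measurability _ (RGenOpens.measurableE R)) => _ [_ [a [b ->] <-]].
rewrite setTI; apply: sub_sigma_algebra; exact/cg/interval_open.
Qed.

Lemma compact_oscillation {R : realType} (Omega : PointedMetric.type R)
    (g : continuousType Omega R) : compact [set: Omega] ->
  exists2 K : R, 0 <= K & forall x y, g x - g y <= K.
Proof.
move=> cO; have cg : {within [set: Omega], continuous g}.
  by apply: continuous_subspaceT; exact: cts_fun.
have [M [_ gM]] := compact_bounded (continuous_compact cg cO).
pose N := `|M| + 1; have MN : M < N by rewrite ltr_pwDr// ler_norm.
have N0 : 0 <= N by rewrite addr_ge0.
exists (N + N); first exact: addr_ge0.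
move=> x y; rewrite (le_trans (ler_norm _))// (le_trans (ler_normB _ _))//.
by apply: lerD; apply: gM.
Qed.

(** * Slater's condition in the bounded densities *)

Lemma linf_density_le {d : measure_display} {T : measurableType d} {R : realType}
    (lambda : {finite_measure set T -> \bar R}) (z : linf lambda) :
  \forall x \ae lambda, `|density z x| <= `|z|.
Proof.
have [fL fz] := densityP z.
have zE : (`|z|%:E = 'N[lambda]_+oo [EFin \o density z])%E.
  exact: linf_norm_density fL fz.
move: zE; rewrite unlock; case: ifPn => [l0 zE|l0 _]; last first.
  (* the norm of a null measure is 0, but then every property holds a.e. *)
  exists setT; split => //.
  by apply/eqP; rewrite -measure_le0 leNgt.
have := ess_sup_ge lambda (abse \o (EFin \o density z)).
by rewrite -zE; apply: filterS => x; rewrite /= lee_fin.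
Qed.

(** The constant density 1 is an order unit. This turns the margin [e] of strict
feasibility into a ball of perturbations in norm. *)
Lemma linf_le_one {d : measure_display} {T : measurableType d} {R : realType}
    (lambda : {finite_measure set T -> \bar R}) (z : linf lambda) (e : R) :
  `|z| <= e -> z ⪯ e *: linf_one lambda.
Proof.
move=> ze E mE.
have [fL fz] := densityP z.
have oneE : (linf_one lambda : smeas T R) E = fine (lambda E).
  by rewrite /= /crestr0 mem_set// /crestr setIT.
have -> : (e *: linf_one lambda : smeas T R) E = e * fine (lambda E).
  by rewrite -oneE.
rewrite -lee_fin fz// EFinM fineK ?fin_num_measure//.
have mf : measurable_fun E (EFin \o density z).
  exact: measurable_funS (measurable_int _ (Lfun_oo_integrable fL)).
apply: (le_trans (lee_abs _)); apply: (le_trans (le_abse_integral _ _ _)) => //.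
rewrite -integral_cst//; apply: ae_ge0_le_integral => //.
- by apply: measurableT_comp.
- by move=> x _; rewrite lee_fin (le_trans _ ze).
- apply: filterS (linf_density_le z) => x zx _.
  by rewrite /= lee_fin (le_trans zx ze).
Qed.

(** * The convergence rates *)

Lemma Hphi_ge0 {d : measure_display} {T : measurableType d} {R : realType}
    (phi : R -> R) (v : smeas T R) (q : prob T R) :
  (forall y : R, 0 < y -> 0 <= phi y) -> (0 <= Hphi phi v q)%E.
Proof.
move=> phi_ge0; rewrite /Hphi; case: ifPn => // _.
by apply: integral_ge0 => x _; exact: phi0_ge0.
Qed.

Lemma primal_solution_le {R : realType} {X : normedModType R}
    {Y : orderedNormedModType R} (a : R) (h : Y -> \bar R) (J : X -> \bar R)
    (Al Au : blin X Y) (u u' : X) (v v' : Y) (delta : R) :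
  0 < a -> (forall w, (0 <= h w)%E) -> (forall w, (0 <= J w)%E) ->
  primal_solution a h J Al Au u v -> feasible Al Au u' v' ->
  (h v' <= delta%:E)%E -> J u' \is a fin_num ->
  [/\ h v \is a fin_num, J u \is a fin_num
    & fine (J u) - fine (J u') <= (delta - fine (h v)) / a].
Proof.
move=> a0 h0 J0 [_ opt] feas hv' Ju'.
have ai0 : 0 < a^-1 by rewrite invr_gt0.
have : (primal_objective a h J u v <= (a^-1 * delta + fine (J u'))%:E)%E.
  apply: (le_trans (opt _ _ feas)).
  by rewrite /primal_objective EFinD fineK// leeD2r// EFinM lee_pmul2l// lte_fin.
rewrite /primal_objective.
have := h0 v; case: (h v) => [x| |]; last by rewrite leeNy_eq.
  have := J0 u; case: (J u) => [y| |]; last by rewrite leeNy_eq.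
    move=> _ _; rewrite -EFinM -EFinD lee_fin => le; split => //=.
    by rewrite mulrBl !(mulrC _ a^-1); lra.
  by move=> _ _; rewrite addey.
move=> _; rewrite gt0_muley ?lte_fin// addye//.
by rewrite gt_eqF// (lt_le_trans _ (J0 u))// ltNy0.
Qed.

Theorem theorem3p7 (R : realType) (U : banachLatticeType R)
  (Omega : PointedMetric.type R) (Omega_compact : compact [set: Omega])
  (phi : R -> R)
  (phi_convex : convex_function [set y : convex_lmodType R^o | 0 < (y : R)] phi)
  (phi1 : phi 1 = 0) (phi_ge0 : forall y : R, 0 < y -> 0 <= phi y)
  (J : U^dual -> \bar R)
  (A : blin (U^dual) (radon Omega)) (Al Au : nat -> blin (U^dual) (radon Omega))
  (A_regular : regular_op A)
  (fbar : prob (borel Omega) R) (f : nat -> prob (borel Omega) R)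
  (alpha delta eta : nat -> R) (alpha_gt0 : forall n, 0 < alpha n)
  (udag : U^dual) (udag_ge0 : dual_ge0 udag)
  (A_udag : A udag = fbar :> radon Omega)
  (udag_min : forall u, A u = fbar :> radon Omega -> (J udag <= J u)%E)
  (J_ge0 : forall u, (0 <= J u)%E) (J_proper : eproper J) (J_convex : econvex J)
  (J_lsc : @lower_semicontinuous (wstar U) R J)
  (J_compact : forall c : R,
     @sequentially_compact (wstar U) [set u | (J u <= c%:E)%E])
  (J_nonempty : exists c : R, [set u | (J u <= c%:E)%E] !=set0)
  (H_proper : eproper (fun vf : radon Omega * prob (borel Omega) R =>
     Hphi phi vf.1 vf.2))
  (H_convex : forall g : prob (borel Omega) R,
     econvex (fun v : radon Omega => Hphi phi v g))
  (H_lsc : @lower_semicontinuous (wstar_radon Omega * wstar_prob Omega)%type R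
     (fun vf => Hphi phi vf.1 vf.2))
  (H_eq0 : forall (v : radon Omega) (g : prob (borel Omega) R),
     Hphi phi v g = 0%E <-> v = g)
  (A_wcont : continuous (A : wstar U -> wstar_radon Omega))
  (Al_wcont : forall n, continuous (Al n : wstar U -> wstar_radon Omega))
  (Au_wcont : forall n, continuous (Au n : wstar U -> wstar_radon Omega))
  (mudag : (radon Omega)^dual * (radon Omega)^dual) (mudag_ge0 : pair_ge0 mudag)
  (source : subdiff J udag (- adjoint (Bop A A) mudag))
  (Al_le : forall n, op_le (Al n) A) (Au_ge : forall n, op_le A (Au n))
  (eta_bound : forall n, `|Au n - Al n| <= eta n) (eta_cvg : eta @ \oo --> 0)
  (delta_bound : forall n, (Hphi phi fbar (f n) <= (delta n)%:E)%E)
  (delta_cvg : delta @ \oo --> 0) (alpha_cvg : alpha @ \oo --> 0)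
  (g : continuousType Omega R)
  (Emudag : forall v : radon Omega, adjoint Eop mudag v = smeas_int v g)
  (r : R -> \bar R) (phi_conjE : forall x, phi_conj phi x = (x%:E + r x)%E)
  (r_small : (r x * (x^-1)%:E)%E @[x --> 0^'] --> 0%E) :
  (forall (u : nat -> U^dual) (v : nat -> radon Omega),
     (forall n, primal_solution (alpha n) (fun w : radon Omega => Hphi phi w (f n))
        J (Al n) (Au n) (u n) (v n)) ->
     rate_bound g r delta alpha eta
       (fun n => bregman J (- adjoint (Bop A A) mudag) (u n) udag)) /\
  (forall (lambda : {finite_measure set (borel Omega) -> \bar R})
     (A' : blin (U^dual) (linf lambda)) (Al' Au' : nat -> blin (U^dual) (linf lambda)),
     (forall u, A' u = A u :> radon Omega) ->
     (forall n u, Al' n u = Al n u :> radon Omega) ->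
     (forall n u, Au' n u = Au n u :> radon Omega) ->
     (forall n, exists (u0 : U^dual) (v0 : linf lambda) (e : R),
        [/\ edom J u0, edom (fun w : linf lambda => Hphi phi w (f n)) v0, 0 < e,
            Al' n u0 + e *: linf_one lambda ⪯ v0
          & v0 ⪯ Au' n u0 - e *: linf_one lambda]) ->
     forall (u : nat -> U^dual) (v : nat -> linf lambda),
     (forall n, primal_solution (alpha n) (fun w : linf lambda => Hphi phi w (f n))
        J (Al' n) (Au' n) (u n) (v n)) ->
     (forall n, exists mu, dual_solution (alpha n)
        (fun w : linf lambda => Hphi phi w (f n)) J (Al' n) (Au' n) mu) /\
     (forall mu : nat -> (linf lambda)^dual * (linf lambda)^dual,
        (forall n, dual_solution (alpha n)
           (fun w : linf lambda => Hphi phi w (f n)) J (Al' n) (Au' n) (mu n)) ->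
        (forall n, subdiff J (u n) (- adjoint (Bop (Al' n) (Au' n)) (mu n))) /\
        rate_bound g r delta alpha eta
          (fun n => (bregman_sym (- adjoint (Bop (Al' n) (Au' n)) (mu n))
             (- adjoint (Bop A A) mudag) (u n) udag)%:E))).
Proof.
have H_ge0 (w : radon Omega) q : (0 <= Hphi phi w q)%E by exact: Hphi_ge0.
have delta_ge0 n : 0 <= delta n by rewrite -lee_fin (le_trans _ (delta_bound n)).
have eta_ge0 n : 0 <= eta n := le_trans (normr_ge0 _) (eta_bound n).
have [Jdag sub_dag] := source.
(* here positivity of [udag] enters *)
have feas_dag n : feasible (Al n) (Au n) udag fbar.
  by split; rewrite -A_udag; [exact: Al_le|exact: Au_ge].
have [M JM] := wstar_sequentially_compact_bounded (J_compact (fine (J udag) + 1)).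
have coercive u t : 0 <= t -> (J u <= J udag + t%:E)%E -> `|u| <= 2 * M * (1 + t).
  apply: (econvex_coercive J_convex Jdag) => w Jw; apply: JM.
  by rewrite /= EFinD fineK.
pose G : (radon Omega)^dual := adjoint Eop mudag.
have sourceE w : (- adjoint (Bop A A) mudag) (w - udag) = - (G (A w) - G fbar).
  rewrite adjoint_BopE -A_udag -[G (A w) - _]linearB -[A w - A udag]linearB /=.
  by rewrite linearN; ring.
(* both distances are nonnegative and lie below this excess *)
have excess_rate (u : nat -> U^dual) (v : nat -> radon Omega) (a : nat -> \bar R) :
    (forall n, feasible (Al n) (Au n) (u n) (v n)) ->
    (forall n, [/\ Hphi phi (v n) (f n) \is a fin_num, J (u n) \is a fin_num
      & fine (J (u n)) - fine (J udag)
        <= (delta n - fine (Hphi phi (v n) (f n))) / alpha n]) ->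
    (forall n, (0 <= a n)%E /\
      (a n <= ((delta n - fine (Hphi phi (v n) (f n))) / alpha n
        + (G (A (u n)) - G fbar))%:E)%E) ->
    rate_bound g r delta alpha eta a.
  move=> feas fin aP.
  have [K K0 gK] := compact_oscillation g Omega_compact.
  apply: (rate_bound_of_bigO _ _ delta_ge0 alpha_gt0 eta_ge0 alpha_cvg K0 gK).
  - exact: (remainder_ge0 phi1 phi_conjE).
  - exact: (remainder_homo phi1 phi_ge0 phi_conjE).
  apply: (excess_bigO (point : borel Omega) phi1 phi_ge0 phi_conjE Al_le Au_ge
    eta_bound eta_cvg alpha_gt0 delta_ge0 delta_bound
    (continuous_borel_measurable g) Emudag _ feas _ aP).
  - move=> n; have [Hn Jn le] := fin n; apply: coercive.
      by rewrite divr_ge0// ltW.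
    rewrite -(fineK Jn) -(fineK Jdag) -EFinD lee_fin addrC -lerBlDr.
    apply: (le_trans le); rewrite ler_pM2r ?invr_gt0// gerBl.
    exact: fine_ge0.
  - by move=> n; have [Hn _ _] := fin n; rewrite fineK.
split=> [u v sol|lambda A' Al' Au' A'E Al'E Au'E slater u v sol].
  have fin n := primal_solution_le (alpha_gt0 n) (fun w => H_ge0 w (f n)) J_ge0
    (sol n) (feas_dag n) (delta_bound n) Jdag.
  apply: (excess_rate u v) => // n; first by have [] := sol n.
  have [Hn Jn le] := fin n.
  rewrite /bregman sourceE; split.
    have := sub_dag (u n); rewrite sourceE.
    by rewrite -(fineK Jn) -(fineK Jdag) -!EFinD !lee_fin; lra.
  by rewrite -(fineK Jn) -(fineK Jdag) -!EFinD lee_fin; lra.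
pose h n (w : linf lambda) := Hphi phi w (f n).
have h_ge0 n w : (0 <= h n w)%E := H_ge0 w (f n).
have h_convex n : econvex (h n) by move=> t w w'; exact: (H_convex (f n)).
pose fbar' : linf lambda := A' udag.
have fbar'E : fbar' = fbar :> radon Omega by rewrite /fbar' A'E.
have feas_dag' n : feasible (Al' n) (Au' n) udag fbar'.
  have [lo up] := feas_dag n.
  split; rewrite /vle/= /linf_le fbar'E.
    by rewrite Al'E.
  by rewrite Au'E.
have h_fbar n : (h n fbar' <= (delta n)%:E)%E by rewrite /h fbar'E.
have fin n := primal_solution_le (alpha_gt0 n) (h_ge0 n) J_ge0
  (sol n) (feas_dag' n) (h_fbar n) Jdag.
have saddle_ex n : exists2 nu, pair_ge0 nu &
    saddle (alpha n) (h n) J (Al' n) (Au' n) (u n) (v n) nu.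
  have [Hn Jn _] := fin n; have [u0 [v0 [e [Ju0 hv0 e0 lo up]]]] := slater n.
  apply: (slater_saddle (alpha_gt0 n) (h_ge0 n) J_ge0 (sol n) Jn Hn
    (h_convex n) J_convex Ju0 hv0 e0) => z ze; split.
    apply: (vle_trans _ _ _ _ lo); rewrite addrC [X in _ ⪯ X]addrC.
    by apply: vle_add2r; apply: linf_le_one; rewrite normrN.
  apply: (vle_trans _ _ _ up); rewrite addrC [X in _ ⪯ X]addrC; apply: vle_add2r.
  rewrite -vsubr_ge0 opprK addrC -[z]opprK vsubr_ge0.
  by apply: linf_le_one; rewrite normrN.
split=> [n|mu mu_sol].
  have [Hn Jn _] := fin n; have [nu nu0 nu_sad] := saddle_ex n; exists nu.
  exact: (saddle_dual_solution (alpha_gt0 n) (h_ge0 n) J_ge0 (sol n) Jn Hn).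
have mu_sad n : saddle (alpha n) (h n) J (Al' n) (Au' n) (u n) (v n) (mu n).
  have [Hn Jn _] := fin n; have [nu nu0 nu_sad] := saddle_ex n.
  exact: (dual_solution_saddle (alpha_gt0 n) (h_ge0 n) J_ge0 Jn Hn nu0 nu_sad).
have sub_n n : subdiff J (u n) (- adjoint (Bop (Al' n) (Au' n)) (mu n)).
  have [Hn Jn _] := fin n; have [mu0 _] := mu_sol n.
  exact: (saddle_subdiff J_ge0 (sol n) Jn Hn mu0 (mu_sad n)).
split=> //; apply: (excess_rate u (fun n => v n : radon Omega)) => // n.
  have [[lo up] _] := sol n; split; last by rewrite -Au'E.
  by rewrite -Al'E.
have [Hn Jn _] := fin n; have [mu0 _] := mu_sol n.
have hbar_fin : h n fbar' \is a fin_num.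
  by rewrite ge0_fin_numE// (le_lt_trans (h_fbar n))// ltry.
have := saddle_subgradient_le (sol n) Jn Hn mu0 (mu_sad n) (feas_dag' n) hbar_fin.
have hbar_le : fine (h n fbar') <= delta n.
  by rewrite -lee_fin fineK.
have ai0 : 0 < (alpha n)^-1 by rewrite invr_gt0.
(* nonnegativity: add the two subgradient inequalities *)
have [_ /(_ udag)] := sub_n n; have := sub_dag (u n).
set pn := - adjoint (Bop (Al' n) (Au' n)) (mu n).
have -> : bregman_sym pn (- adjoint (Bop A A) mudag) (u n) udag =
  pn (u n - udag) - (- adjoint (Bop A A) mudag) (u n - udag) by [].
rewrite sourceE -[udag - u n]opprB linearN -(fineK Jn) -(fineK Jdag) -!EFinD !lee_fin.
move=> le1 le2 le3; split; first by lra.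
suff : (alpha n)^-1 * (fine (h n fbar') - fine (h n (v n))) <=
  (delta n - fine (h n (v n))) / alpha n by lra.
by rewrite mulrC ler_pM2r// lerD2r.
Qed.
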